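(* Let $d\ge 1$ and let $(X_i, i\ge 1)$ be independent, identically distributed, centered, $\mathbb{R}^d$-valued random variables with finite, non-degenerate covariance matrix $\Sigma$, defined on a common probability space. For integers $n\ge 1$ let $S_n=X_1+\dots+X_n$, and let $\xi\sim\mathcal{N}(0,\Sigma)$. Then for all $f\in C^4(\mathbb{R}^d)$ with $|f(x)|\to 0$ as $|x|\to\infty$, there exists a constant $C=C(d,\|f\|_{C^4},\Sigma)$, depending only on $d$, $\|f\|_{C^4}$ and $\Sigma$, such that for all $\gamma\in(0,1]$ and all integers $n\ge 1$, $$\left|\mathbb{E}\left[f\left(\frac{S_n}{n^{1/2}}\right)\right]-\mathbb{E}[f(\xi)]\right|\le \frac{C\,\mathbb{E}\left[|X_1|^{2+\gamma}\right]}{n^{\gamma/2}}.$$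
   Context: $C^k(\mathbb{R}^d)$ denotes the set of functions $f:\mathbb{R}^d\to\mathbb{R}$ for which all partial derivatives of order up to $k$ exist and are uniformly bounded. For $f\in C^k(\mathbb{R}^d)$, $\|f\|_{C^k}=\sum_{0\le|\alpha|\le k}\|\partial^\alpha f\|_\infty$, the sum being over multi-indices $\alpha=(\alpha_1,\dots,\alpha_d)$ of nonnegative integers with $|\alpha|=\sum_i\alpha_i\le k$ (and $\partial^\alpha f=f$ when $|\alpha|=0$). $|\cdot|$ is the Euclidean norm on $\mathbb{R}^d$. The bound is vacuous when $\mathbb{E}[|X_1|^{2+\gamma}]=\infty$. *)

(* Defs.v *)
From HB Require Import structures.
From mathcomp Require Import all_boot all_order all_algebra.
From mathcomp Require Import all_classical all_reals all_analysis.

Set Implicit Arguments.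
Unset Strict Implicit.
Unset Printing Implicit Defensive.

Import Order.TTheory GRing.Theory Num.Theory.
Import numFieldNormedType.Exports.

Local Open Scope classical_set_scope.
Local Open Scope ring_scope.

(* Euclidean norm; the library norm `|x| on 'rV[R]_d is the sup norm. *)
Definition enorm (R : realType) (d : nat) (x : 'rV[R]_d) : R :=
  Num.sqrt (\sum_(i < d) x 0 i ^+ 2).

Definition vanishes_at_infinity (R : realType) (d : nat)
    (f : 'rV[R]_d -> R) : Prop :=
  forall e : R, 0 < e -> exists A : R, forall x, A < enorm x -> `|f x| < e.

(* pderiv [:: i1; ...; ik] f is the iterated partial derivative
   d_i1 (d_i2 (... (d_ik f))), and f itself for the empty sequence. *)
Definition pderiv (R : realType) (d : nat) (s : seq 'I_d)
    (f : 'rV[R]_d -> R) : 'rV[R]_d -> R :=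
  foldr (fun i g => fun x => 'D_(delta_mx 0 i) g x) f s.

(* All partial derivatives of order at most k, taken in any order of
   differentiation, exist everywhere and are bounded. As 'D_ v g x is a total
   operator, existence is the separate derivability clause. *)
Definition Ck (R : realType) (d k : nat) (f : 'rV[R]_d -> R) : Prop :=
  (forall (s : seq 'I_d) (i : 'I_d) (x : 'rV[R]_d), (size s < k)%N ->
     derivable (pderiv s f) x (delta_mx 0 i)) /\
  (forall s : seq 'I_d, (size s <= k)%N ->
     exists M : R, forall x, `|pderiv s f x| <= M).

(* d^alpha f = d_1^alpha_1 ... d_d^alpha_d f *)
Definition mderiv (R : realType) (d k : nat) (a : {ffun 'I_d -> 'I_k.+1})
    (f : 'rV[R]_d -> R) : 'rV[R]_d -> R :=
  pderiv (flatten [seq nseq (a i) i | i <- enum 'I_d]) f.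

(* Every multi-index of length at most k has entries at most k, hence the
   encoding by {ffun 'I_d -> 'I_k.+1}. The real-valued sup is the true
   supremum when f is Ck k. *)
Definition Ck_norm (R : realType) (d k : nat) (f : 'rV[R]_d -> R) : R :=
  \sum_(a : {ffun 'I_d -> 'I_k.+1} | (\sum_(i < d) a i <= k)%N)
     sup (range (fun x => `|mderiv a f x|)).

Notation borel_rV R d := (g_sigma_algebraType (@open 'rV[R]_d)).

Definition rv_val (R : realType) (d : nat) (x : borel_rV R d) : 'rV[R]_d := x.

Definition mutually_independent (R : realType) (dT dT' : measure_display)
    (T : measurableType dT) (T' : measurableType dT') (P : probability T R)
    (I : eqType) (X : I -> {RV P >-> T'}) : Prop :=
  forall (J : seq I) (B : I -> set T'), uniq J ->
    (forall i, measurable (B i)) ->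
    P (\big[setI/setT]_(i <- J) (X i @^-1` B i)) =
    (\prod_(i <- J) P (X i @^-1` B i))%E.

Definition identically_distributed (R : realType) (dT dT' : measure_display)
    (T : measurableType dT) (T' : measurableType dT') (P : probability T R)
    (I : Type) (X : I -> {RV P >-> T'}) : Prop :=
  forall (i j : I) (B : set T'), measurable B ->
    distribution P (X i) B = distribution P (X j) B.

Definition centered (R : realType) (d : nat) (dT : measure_display)
    (T : measurableType dT) (P : probability T R)
    (X : {RV P >-> borel_rV R d}) : Prop :=
  forall i : 'I_d, 'E_P[fun w => rv_val (X w) 0%R i]%E = 0%E.

(* X has the (finite) covariance matrix S. *)
Definition has_covariance (R : realType) (d : nat) (dT : measure_display)
    (T : measurableType dT) (P : probability T R)
    (X : {RV P >-> borel_rV R d}) (S : 'M[R]_d) : Prop :=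
  forall i j : 'I_d,
    covariance P (fun w => rv_val (X w) 0 i) (fun w => rv_val (X w) 0 j) =
    (S i j)%:E.

(* xi ~ N(0, S): almost surely xi = A Z, with A A^T = S and Z a vector of
   independent standard normal variables. *)
Definition gaussian_vector (R : realType) (d : nat) (dT : measure_display)
    (T : measurableType dT) (P : probability T R)
    (xi : {RV P >-> borel_rV R d}) (S : 'M[R]_d) : Prop :=
  exists (l : nat) (A : 'M[R]_(d, l)) (Z : 'I_l -> {RV P >-> R}),
    [/\ A *m A^T = S,
        mutually_independent Z,
        forall (j : 'I_l) (B : set R), measurable B ->
          distribution P (Z j) B = normal_prob 0 1 B
      & {ae P, forall w, forall i : 'I_d,
          rv_val (xi w) 0 i = \sum_(j < l) A i j * Z j w}].

Definition normalized_sum (R : realType) (d : nat) (dT : measure_display)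
    (T : measurableType dT) (P : probability T R)
    (X : nat -> {RV P >-> borel_rV R d}) (n : nat) (w : T) : 'rV[R]_d :=
  (Num.sqrt n%:R)^-1 *: \sum_(i < n) rv_val (X i w).

(* Main.v *)
(* Lindeberg's exchange argument, run on the commuting averaging operators
   (A_Y g)(x) = E g(x + Y). With h = n^(-1/2), independence gives
   E f(S_n / n^(1/2)) = (A_{hX}^n f)(0), and stability of the normal law gives
   E f(xi) = (A_{h xi}^n f)(0). Since the two operators commute and are monotone
   contractions, |A_{hX}^n f - A_{h xi}^n f| <= n sup |A_{hX} f - A_{h xi} f|, so f
   never has to be smoothed and its averages need not be differentiable. X and
   xi have the same first two moments, hence a second order Taylor expansion of
   f, whose remainder is O(min(|y|^2, |y|^3)) = O(|y|^(2+gamma)), bounds the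
   one-step difference by C h^(2+gamma) (E|X|^(2+gamma) + E|xi|^(2+gamma)). The
   Gaussian moment is bounded in terms of Sigma, and E|X|^(2+gamma) is bounded
   below in terms of trace Sigma > 0, so the former is absorbed in the latter. *)

Require Import Defs.
From mathcomp Require Import all_boot all_order all_algebra.
From mathcomp Require Import all_classical all_reals all_analysis.
From mathcomp Require Import measurable_realfun ring lra.
Import Order.TTheory GRing.Theory Num.Theory.
Import numFieldNormedType.Exports.
Local Open Scope classical_set_scope.
Local Open Scope ring_scope.

Set Implicit Arguments.
Unset Strict Implicit.
Unset Printing Implicit Defensive.

(** * Borel sets of the space of row vectors *)

(** Two constraints shape the proof. The constant is fixed before the laws and [gamma] are given, so
    every moment estimate has to be uniform in [gamma]; this is why the Gaussian moment is dominated
    by [1] plus fourth moments. And [Ck] speaks of partial derivatives only, with a norm that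
    records each multi-index once, so Taylor expansions move one coordinate at a time. The averaging
    operators act on nonnegative extended-real functions, where Tonelli's theorem asks for no
    integrability. The function [f] enters as [f + B] with [B] a bound of [|f|], and the operators
    carry the shift along unchanged. The Gaussian operator is factored into one-dimensional normal
    averages along the columns of a matrix [A] with [A *m A^T = Sigma]. Stability of the Gaussian
    law then reduces to the convolution of two normal densities, and no independent copies of [xi]
    are ever built. *)

Lemma continuous_measurable_rV (R : realType) (d : nat) (f : 'rV[R]_d -> R) :
  continuous f -> measurable_fun [set: borel_rV R d] (f : borel_rV R d -> R).
Proof.
move=> /continuousP cf; apply: (measurability _ (RGenOpens.measurableE R)).
move=> _ [_ [a [b ->] <-]]; rewrite setTI; apply: sub_sigma_algebra.
exact/cf/interval_open.
Qed.

Lemma measurable_coord (R : realType) (d : nat) (i : 'I_d) :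
  measurable_fun [set: borel_rV R d] (fun x : borel_rV R d => rv_val x 0 i).
Proof. exact: (continuous_measurable_rV (@coord_continuous R 1 d 0 i)). Qed.

(* Every open set is the countable union of the open boxes with rational
   centre and radius 1/(k+1) that it contains. *)
Lemma measurable_fun_rV (R : realType) (d : nat) (dT : measure_display)
    (T : measurableType dT) (Y : T -> borel_rV R d) :
  (forall i : 'I_d, measurable_fun [set: T] (fun w => rv_val (Y w) 0 i)) ->
  measurable_fun [set: T] Y.
Proof.
move=> mY; have := @measurability dT _ T (borel_rV R d) setT Y (@open 'rV[R]_d) erefl; apply.
move=> _ [U oU <-]; rewrite setTI.
pose box (q : 'rV[rat]_d * nat) : set 'rV[R]_d :=
  [set x | forall i, `|x 0 i - ratr (q.1 0 i)| < q.2.+1%:R^-1].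
pose F (q : 'rV[rat]_d * nat) : set T :=
  if `[< box q `<=` U >] then Y @^-1` box q else set0.
have -> : Y @^-1` U = \bigcup_q F q.
  apply/seteqP; split => [w /= Uw|w [q _]]; last first.
    by rewrite /F; case: asboolP => // + bq; apply.
  have [e /= e0 eU] := (nbhs_ballP (Y w : 'rV[R]_d) _).1 (open_nbhs_nbhs (conj oU Uw)).
  have [k ke] : exists k : nat, k.+1%:R^-1 < e / 2.
    have e2 : 0 < e / 2 by rewrite divr_gt0.
    exists (Num.truncn (e / 2)^-1).
    by rewrite invf_plt ?posrE//; exact: truncnS_gt.
  have k0 : (0 : R) < k.+1%:R^-1 by rewrite invr_gt0.
  have /choice[q hq] : forall i, exists q : rat,
      `|(Y w : 'rV[R]_d) 0 i - ratr q| < k.+1%:R^-1.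
    move=> i; have lt2 : (Y w : 'rV[R]_d) 0 i - k.+1%:R^-1 < (Y w : 'rV[R]_d) 0 i + k.+1%:R^-1.
      by rewrite ltrD2l gtrN.
    have [q] := rat_in_itvoo lt2; rewrite in_itv/= => /andP[h1 h2]; exists q.
    by rewrite distrC ltr_distl h1 h2.
  exists (\row_i q i, k) => //; rewrite /F asboolT.
    by move=> i /=; rewrite mxE.
  move=> x hx; apply: eU; split => // a i; rewrite (ord1 a).
  have := hx i; rewrite /= mxE => hxi.
  rewrite /ball /= -(subrK (ratr (q i)) ((Y w : 'rV[R]_d) 0 i)) -addrA.
  rewrite (le_lt_trans (ler_normD _ _))//.
  rewrite (_ : e = e / 2 + e / 2); last by rewrite -splitr.
  by rewrite ltrD// ?(lt_trans (hq _))// distrC (lt_trans hxi).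
apply: countable_bigcupT_measurable => [|q]; first exact: countableP.
rewrite /F; case: asboolP => // _.
have -> : Y @^-1` box q = \bigcap_(i in [set: 'I_d])
    ((fun w => rv_val (Y w) 0 i) @^-1` [set r | `|r - ratr (q.1 0 i)| < q.2.+1%:R^-1]).
  by apply/seteqP; split => w /= h i => [_|]; exact: h.
apply: fin_bigcap_measurable => [|i _]; first exact: finite_finset.
rewrite -[X in measurable X]setTI; apply: mY => //.
rewrite (_ : [set _ | _] = ball (ratr (q.1 0 i) : R) q.2.+1%:R^-1).
  exact: measurable_ball.
by apply/seteqP; split => r /=; rewrite /ball/= distrC.
Qed.

Lemma measurable_funD_rV (R : realType) (d : nat) (dT : measure_display)
    (T : measurableType dT) (Y Z : T -> borel_rV R d) :
  measurable_fun [set: T] Y -> measurable_fun [set: T] Z ->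
  measurable_fun [set: T] (fun w => Y w + Z w : borel_rV R d).
Proof.
move=> mY mZ; apply: measurable_fun_rV => i; rewrite /rv_val.
under eq_fun do rewrite mxE.
apply: measurable_funD.
- exact: (measurableT_comp (measurable_coord i) mY).
- exact: (measurableT_comp (measurable_coord i) mZ).
Qed.

Lemma measurable_funZ_rV (R : realType) (d : nat) (dT : measure_display)
    (T : measurableType dT) (k : T -> R) (Y : T -> borel_rV R d) :
  measurable_fun [set: T] k -> measurable_fun [set: T] Y ->
  measurable_fun [set: T] (fun w => k w *: Y w : borel_rV R d).
Proof.
move=> mk mY; apply: measurable_fun_rV => i; rewrite /rv_val.
under eq_fun do rewrite mxE.
apply: measurable_funM => //.
exact: (measurableT_comp (measurable_coord i) mY).
Qed.

(** * Averaging operators *)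

(** Each operator carries its own probability space, so that [P], [Q] and the normal law on the line
    are treated alike. Values in the extended reals make the integral of a nonnegative function
    meaningful unconditionally. *)
Definition avg (R : realType) (d : nat) (dT : measure_display)
    (T : measurableType dT) (m : probability T R) (Y : T -> borel_rV R d)
    (g : borel_rV R d -> \bar R) (x : borel_rV R d) : \bar R :=
  (\int[m]_w g (x + Y w)%R)%E.

Definition nonneg_measurable (R : realType) (dT : measure_display)
    (T : measurableType dT) (g : T -> \bar R) : Prop :=
  measurable_fun [set: T] g /\ (forall x, 0 <= g x)%E.

Section avg.
Context (R : realType) (d : nat).
Implicit Types (g : borel_rV R d -> \bar R) (x : borel_rV R d).

Lemma measurable_shift (dT : measure_display) (T : measurableType dT)
    (Y : T -> borel_rV R d) g x :
  measurable_fun [set: T] Y -> nonneg_measurable g ->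
  measurable_fun [set: T] (fun w => g (x + Y w)).
Proof.
move=> mY [mg _]; apply: (measurableT_comp mg).
exact: (measurable_funD_rV (measurable_cst (x : borel_rV R d)) mY).
Qed.

Lemma measurable_shift2 (dT dU : measure_display) (T : measurableType dT)
    (U : measurableType dU) (Y : T -> borel_rV R d) (Z : U -> borel_rV R d) g x :
  measurable_fun [set: T] Y -> measurable_fun [set: U] Z ->
  nonneg_measurable g ->
  measurable_fun [set: T * U] (fun p => g (x + Y p.1 + Z p.2)).
Proof.
move=> mY mZ [mg _]; apply: (measurableT_comp mg).
apply: measurable_funD_rV; last exact: (measurableT_comp mZ (measurable_snd (T1:=T))).
apply: (measurable_funD_rV (measurable_cst (x : borel_rV R d))).
exact: (measurableT_comp mY (measurable_fst (T2:=U))).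
Qed.

Lemma nonneg_measurable_avg (dT : measure_display) (T : measurableType dT)
    (m : probability T R) (Y : T -> borel_rV R d) g :
  measurable_fun [set: T] Y -> nonneg_measurable g ->
  nonneg_measurable (avg m Y g).
Proof.
move=> mY [mg g0]; split => [|x]; last by apply: integral_ge0 => w _.
pose f (p : borel_rV R d * T) : \bar R := g (p.1 + Y p.2).
have mf : measurable_fun setT f.
  apply: (measurableT_comp mg); apply: measurable_funD_rV.
  - exact: measurable_fst.
  - exact: (measurableT_comp mY (measurable_snd (T1:=borel_rV R d))).
have f0 p : (0 <= f p)%E by exact: g0.
exact: (measurable_fun_fubini_tonelli_F (m2 := m) f mf f0).
Qed.

(** Both sides integrate [g (x + Y + Z)] over the product space, in the two orders. The two spaces
    are unrelated: only the laws matter, not any coupling of [Y] and [Z]. *)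
Lemma avg_comm (dT dU : measure_display) (T : measurableType dT)
    (U : measurableType dU) (m : probability T R) (m' : probability U R)
    (Y : T -> borel_rV R d) (Z : U -> borel_rV R d) g :
  measurable_fun [set: T] Y -> measurable_fun [set: U] Z ->
  nonneg_measurable g ->
  avg m Y (avg m' Z g) = avg m' Z (avg m Y g).
Proof.
move=> mY mZ hg; apply/funext => x.
pose f (p : T * U) : \bar R := g (x + Y p.1 + Z p.2).
have f0 p : (0 <= f p)%E by exact: hg.2.
rewrite /avg.
rewrite (fubini_tonelli (m1 := m) (m2 := m') f (measurable_shift2 x mY mZ hg) f0).
by apply: eq_integral => u _; apply: eq_integral => w _; rewrite /f /= addrAC.
Qed.

Lemma le_avg (dT : measure_display) (T : measurableType dT)
    (m : probability T R) (Y : T -> borel_rV R d) g g' x :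
  measurable_fun [set: T] Y -> nonneg_measurable g -> nonneg_measurable g' ->
  (forall y, g y <= g' y)%E -> (avg m Y g x <= avg m Y g' x)%E.
Proof.
move=> mY hg hg' gg'; rewrite /avg; apply: ge0_le_integral => //.
- by move=> w _; case: hg.
- exact: measurable_shift.
- exact: measurable_shift.
Qed.

Lemma avgD_cst (dT : measure_display) (T : measurableType dT)
    (m : probability T R) (Y : T -> borel_rV R d) g x (c : R) :
  measurable_fun [set: T] Y -> nonneg_measurable g -> 0 <= c ->
  avg m Y (fun y => g y + c%:E)%E x = (avg m Y g x + c%:E)%E.
Proof.
move=> mY hg c0; rewrite /avg ge0_integralD//.
- by congr (_ + _)%E; rewrite integral_cst//= probability_setT mule1.
- by move=> w _; case: hg.
- exact: measurable_shift.
Qed.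

Lemma nonneg_measurableD_cst g (c : R) :
  nonneg_measurable g -> 0 <= c -> nonneg_measurable (fun y => g y + c%:E)%E.
Proof.
move=> [mg g0] c0; split; first exact: emeasurable_funD.
by move=> x; rewrite adde_ge0.
Qed.

Lemma nonneg_measurable_foldr (I : Type) (A : I -> (borel_rV R d -> \bar R) ->
    borel_rV R d -> \bar R) (s : seq I) g :
  (forall i h, nonneg_measurable h -> nonneg_measurable (A i h)) ->
  nonneg_measurable g -> nonneg_measurable (foldr A g s).
Proof. by move=> hA hg; elim: s => //= i s IH; exact: hA. Qed.

Lemma nonneg_measurable_iter (A : (borel_rV R d -> \bar R) ->
    borel_rV R d -> \bar R) n g :
  (forall h, nonneg_measurable h -> nonneg_measurable (A h)) ->
  nonneg_measurable g -> nonneg_measurable (iter n A g).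
Proof. by move=> hA hg; elim: n => //= n IH; exact: hA. Qed.

(* The operators commute, so the telescoping sum of Lindeberg's exchange needs
   the one-step comparison only for g itself, never for its averages. *)
Lemma iter_avg_le (dT dU : measure_display) (T : measurableType dT)
    (U : measurableType dU) (m : probability T R) (m' : probability U R)
    (Y : T -> borel_rV R d) (Z : U -> borel_rV R d) g (e : R) n x :
  measurable_fun [set: T] Y -> measurable_fun [set: U] Z ->
  nonneg_measurable g -> 0 <= e ->
  (forall y, avg m Y g y <= avg m' Z g y + e%:E)%E ->
  (iter n (avg m Y) g x <= iter n (avg m' Z) g x + (n%:R * e)%:E)%E.
Proof.
move=> mY mZ hg e0 hYZ.
have nmY h := @nonneg_measurable_avg _ _ m _ h mY.
have nmZ h := @nonneg_measurable_avg _ _ m' _ h mZ.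
elim: n x => [|n IH] x /=; first by rewrite mul0r adde0.
have nY := nonneg_measurable_iter n nmY hg.
have nZ := nonneg_measurable_iter n nmZ hg.
(* One [Z]-average is moved outside all [Y]-averages, where the induction hypothesis can be used
   under it. *)
have swap k : avg m' Z (iter k (avg m Y) g) = iter k (avg m Y) (avg m' Z g).
  elim: k => //= k IHk.
  by rewrite (avg_comm _ _ mZ mY (nonneg_measurable_iter k nmY hg)) IHk.
(* The error [e] is not amplified by further averaging, since averages fix constants. *)
have step k y :
    (iter k (avg m Y) (avg m Y g) y <= iter k (avg m Y) (avg m' Z g) y + e%:E)%E.
  elim: k y => //= k IHk y.
  have nk h : nonneg_measurable h -> nonneg_measurable (iter k (avg m Y) h).
    exact: nonneg_measurable_iter.
  rewrite -avgD_cst//; last exact/nk/nmZ.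
  apply: le_avg => //; first exact/nk/nmY.
  by apply: nonneg_measurableD_cst => //; exact/nk/nmZ.
(* The chain is A_Y^(n+1) g <= A_Y^n A_Z g + e = A_Z A_Y^n g + e, and then the induction hypothesis
   inside A_Z. *)
rewrite -iterS iterSr (le_trans (step n x))// -swap.
have ne0 : 0 <= n%:R * e by rewrite mulr_ge0.
apply: (@le_trans _ _ (avg m' Z (fun y => iter n (avg m' Z) g y + (n%:R * e)%:E) x + e%:E))%E.
  rewrite leeD2r//; apply: le_avg => //.
  exact: nonneg_measurableD_cst.
by rewrite avgD_cst// -addeA -EFinD -natr1 mulrDl mul1r.
Qed.

End avg.

(** * Sums of independent vectors *)

(* The measure m stands for P restricted to an event independent of (U, V). *)
Lemma product_rule_joint (R : realType) (dT d1 d2 : measure_display)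
    (T : measurableType dT) (T1 : measurableType d1) (T2 : measurableType d2)
    (P : probability T R) (U : {RV P >-> T1}) (V : {RV P >-> T2})
    (m : {measure set T -> \bar R}) (p : R) :
  0 <= p ->
  (forall A B, measurable A -> measurable B ->
     m (U @^-1` A `&` V @^-1` B) = (p%:E * (P (U @^-1` A) * P (V @^-1` B)))%E) ->
  forall C : set (T1 * T2), measurable C ->
    m ((fun w => (U w, V w)) @^-1` C) =
    (p%:E * (distribution P U \x distribution P V) C)%E.
Proof.
move=> p0 mE C mC.
have mUV : measurable_fun setT (fun w => (U w, V w)).
  by apply: measurable_fun_pair; exact: measurable_funP.
have [p_eq0|p_neq0] := eqVneq p 0.
  rewrite p_eq0 mul0e; apply/eqP; rewrite eq_le measure_ge0 andbT.
  have <- : m setT = 0%E.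
    have := mE setT setT measurableT measurableT.
    by rewrite !preimage_setT setIT p_eq0 mul0e.
  by apply: le_measure; rewrite ?inE// -[X in measurable X]setTI; exact: mUV.
have pV0 : 0 <= p^-1 by rewrite invr_ge0.
(* Divided by [p], the image of [m] agrees with the product measure on rectangles, and rectangles
   determine that measure. *)
have [m' m'E] : exists m' : {measure set (T1 * T2)%type -> \bar R},
    forall A, m' A = (p^-1%:E * m ((fun w => (U w, V w)) @^-1` A))%E.
  by unshelve eexists (mscale (NngNum pV0) (pushforward m (fun w => (U w, V w)))).
rewrite (@product_measure_unique _ _ _ _ _ _ _ m') //.
  by rewrite m'E muleA -EFinM mulfV// mul1e.
move=> A B mA mB; rewrite m'E.
rewrite [X in m X](_ : _ = U @^-1` A `&` V @^-1` B); last first.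
  by apply/seteqP; split => w /=.
by rewrite mE// muleA -EFinM mulVf// mul1e.
Qed.

Section independent_sum.
Context (R : realType) (d : nat) (dT dT' : measure_display)
  (T : measurableType dT) (T' : measurableType dT') (P : probability T R)
  (I : eqType) (X : I -> {RV P >-> T'}) (u : I -> T' -> borel_rV R d).
Hypothesis indX : mutually_independent X.
Hypothesis mu : forall i, measurable_fun [set: T'] (u i).

Let S (s : seq I) (w : T) : borel_rV R d := \sum_(i <- s) u i (X i w).

Let uX i : measurable_fun [set: T] (fun w => u i (X i w)).
Proof. by apply: (measurableT_comp (mu i)); exact: measurable_funP. Qed.

Lemma measurable_sum_rV s : measurable_fun [set: T] (S s).
Proof.
elim: s => [|i s IH].
  rewrite /S; under eq_fun do rewrite big_nil.
  exact: (measurable_cst (0 : borel_rV R d)).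
rewrite /S; under eq_fun do rewrite big_cons.
exact: measurable_funD_rV.
Qed.

Let Sm s : {RV P >-> borel_rV R d} := mfun_Sub (mem_set (measurable_sum_rV s)).

Let E (J : seq I) (B : I -> set T') : set T :=
  \big[setI/setT]_(j <- J) (X j @^-1` B j).

Let mE J B : (forall i, measurable (B i)) -> measurable (E J B).
Proof.
by move=> mB; apply: bigsetI_measurable => i _; exact: measurable_funPTI.
Qed.

Let add i (p : borel_rV R d * T') : borel_rV R d := u i p.2 + p.1.

Let madd i : measurable_fun setT (add i).
Proof.
apply: (measurable_funD_rV _ (measurable_fst (T2:=T'))) => //.
exact: (measurableT_comp (mu i) (measurable_snd (T1:=borel_rV R d))).
Qed.

(** The induction hypothesis carries an arbitrary event on indices outside [s]: when a new index
    joins the sum, its own event is taken from that family. *)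
Let factors s := forall J B A, uniq (s ++ J) -> (forall i, measurable (B i)) ->
  measurable A -> P (S s @^-1` A `&` E J B) = (P (S s @^-1` A) * P (E J B))%E.

(** On rectangles, the event on [X i] is absorbed into the family over [J]. The extension to every
    measurable [C] is the point, because the preimage of a Borel set under addition is not a
    rectangle. *)
Let joint i s J B : factors s -> uniq (i :: s ++ J) ->
  (forall i, measurable (B i)) ->
  forall C, measurable C ->
    P ((fun w => (S s w, X i w)) @^-1` C `&` E J B) =
    (P (E J B) * (distribution P (Sm s) \x distribution P (X i)) C)%E.
Proof.
move=> IH /= /andP[iN usJ] mB C mC.
have fE : P (E J B) \is a fin_num by rewrite fin_num_measure//; exact: mE.
have mP := @product_rule_joint _ _ _ _ _ _ _ P (Sm s) (X i)
  (mrestr P (mE J mB)) (fine (P (E J B))).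
rewrite -(fineK fE) -mP//; first by rewrite fine_ge0.
move=> A D mA mD; rewrite /mrestr fineK//.
(* Redefining [B] at [i] makes the event on [X i] and [E J B] a single event of the same form, over
   [i :: J]. *)
pose B' j := if j == i then D else B j.
have mB' j : measurable (B' j) by rewrite /B'; case: ifP.
have iNJ : i \notin J by apply: contra iN; rewrite mem_cat => ->; rewrite orbT.
have EJ : E J B' = E J B.
  apply: eq_big_seq => j jJ; rewrite /B'; case: eqP => // ji.
  by move: iNJ; rewrite -ji jJ.
have EiJ : E (i :: J) B' = X i @^-1` D `&` E J B.
  by rewrite /E big_cons /B' eqxx -/(E J B') EJ.
rewrite [LHS](_ : _ = P (S s @^-1` A `&` E (i :: J) B')); last first.
  by rewrite EiJ setIA.
rewrite IH//; last first.
  rewrite uniq_catC /= mem_cat negb_or iNJ /=.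
  move: iN; rewrite mem_cat negb_or => /andP[-> _] /=.
  by rewrite uniq_catC.
rewrite /E indX//; last first.
  by rewrite /= iNJ; move: usJ; rewrite cat_uniq => /and3P[].
rewrite big_cons {1}/B' eqxx [in RHS]muleC -muleA; congr (_ * (_ * _))%E.
rewrite indX//; last by move: usJ; rewrite cat_uniq => /and3P[].
apply: eq_big_seq => j jJ; rewrite /B'; case: eqP => // ji.
by move: iNJ; rewrite -ji jJ.
Qed.

Let sum_factors s : factors s.
Proof.
elim: s => [|i s IH] J B A.
  move=> _ mB mA; rewrite /S.
  have [A0|A0] := pselect (A 0).
    rewrite [X in P X](_ : _ = E J B); last first.
      apply/seteqP; split => [w []//|w Ew]; split => //=.
      by rewrite big_nil.
    rewrite [X in (P X * _)%E](_ : _ = setT) ?probability_setT ?mul1e//.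
    by apply/seteqP; split => w //= _; rewrite big_nil.
  rewrite [X in P X](_ : _ = set0); last first.
    by apply/seteqP; split => [w []|w //]; rewrite /= big_nil.
  rewrite [X in (P X * _)%E](_ : _ = set0) ?measure0 ?mul0e//.
  by apply/seteqP; split => [w|w //]; rewrite /= big_nil.
move=> us mB mA.
have mC : measurable (add i @^-1` A).
  by rewrite -[X in measurable X]setTI; exact: madd.
have SE : S (i :: s) @^-1` A = (fun w => (S s w, X i w)) @^-1` (add i @^-1` A).
  by apply/seteqP; split => w; rewrite /= /S /add big_cons.
have us' : uniq (i :: s ++ [::]).
  by rewrite cats0; move: us; rewrite cat_uniq => /andP[].
(* The empty family has probability one, which yields the product law of the pair [(S s, X i)]
   alone. *)
have := joint IH us' mB mC; rewrite {1 2}/E big_nil setIT probability_setT mul1e.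
move=> h0; rewrite SE h0 (joint IH us mB mC) muleC; congr (_ * _)%E.
Qed.

(** The pair formed by the sum over [s] and [X i] has a product law, so Tonelli splits off the
    average over [X i], one variable at a time. The maps [u i] serve both the rescaled summands and
    the Gaussian components along columns. *)
Lemma integral_independent_sum s (g : borel_rV R d -> \bar R) x :
  uniq s -> nonneg_measurable g ->
  (\int[P]_w g (x + \sum_(i <- s) u i (X i w))%R)%E =
  foldr (fun i => avg P (fun w => u i (X i w))) g s x.
Proof.
move=> + hg; elim: s x => [|i s IH] x us /=.
  under eq_integral do rewrite big_nil addr0.
  by rewrite integral_cst//= probability_setT mule1.
have nng : nonneg_measurable (foldr (fun i => avg P (fun w => u i (X i w))) g s).
  by apply: nonneg_measurable_foldr => // j h; exact: nonneg_measurable_avg.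
pose f (p : borel_rV R d * T') : \bar R := g (x + (u i p.2 + p.1)).
have mf : measurable_fun setT f.
  apply: (measurableT_comp hg.1).
  exact: (measurable_funD_rV (measurable_cst (x : borel_rV R d)) (madd i)).
have f0 p : (0 <= f p)%E by exact: hg.2.
have mSX : measurable_fun setT (fun w => (S s w, X i w)).
  by apply: measurable_fun_pair; [exact: measurable_sum_rV|exact: measurable_funP].
transitivity (\int[P]_w f (S s w, X i w))%E.
  by apply: eq_integral => w _; rewrite big_cons.
transitivity (\int[distribution P (Sm s) \x distribution P (X i)]_p f p)%E.
  have := @ge0_integral_pushforward _ _ _ _ _ _ mSX P setT f measurableT mf.
  rewrite preimage_setT /comp => <-; last by move=> p _.
  apply: eq_measure_integral => C mC _ /=; rewrite /pushforward.
  have us' : uniq (i :: s ++ [::]) by rewrite cats0.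
  have := joint (@sum_factors s) us' (fun=> measurableT) mC.
  by rewrite {1 2}/E big_nil setIT probability_setT mul1e.
rewrite fubini_tonelli2// ge0_integral_distribution; last 2 first.
- exact: measurable_fun_fubini_tonelli_G.
- by move=> y; apply: integral_ge0 => z _.
apply: eq_integral => w _; rewrite /comp /fubini_G.
rewrite ge0_integral_distribution; last 2 first.
- exact: (measurableT_comp mf (pair2_measurable (X i w))).
- by move=> y.
rewrite -IH//; last by case/andP: us.
by apply: eq_integral => z _; rewrite /f /= addrA.
Qed.

End independent_sum.

(** * The standard normal law *)

(** As a function of [A] the right-hand side is a measure that gives half-open intervals their
    length, and this characterizes Lebesgue measure. *)
Lemma lebesgue_measure_affine (R : realType) (a b : R) (A : set R) :
  a != 0 -> measurable A ->
  lebesgue_measure A =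
  (`|a|%:E * lebesgue_measure ((fun x => a * x + b)%R @^-1` A))%E.
Proof.
move=> a0 mA; have na : 0 <= `|a| by [].
have mf : measurable_fun [set: measurableTypeR R]
    ((fun x => a * x + b) : _ -> measurableTypeR R).
  by apply: measurable_funD => //; exact: measurable_funM.
have [m mE] : exists m : {measure set (measurableTypeR R) -> \bar R},
    forall B, m B = (`|a|%:E * lebesgue_measure ((fun x => a * x + b)%R @^-1` B))%E.
  by unshelve eexists (mscale (NngNum na)
    (pushforward (lebesgue_measure : {measure set (measurableTypeR R) -> \bar R})
      ((fun x => a * x + b) : measurableTypeR R -> measurableTypeR R))).
rewrite -mE; apply: (@lebesgue_measure_unique R m) => // X [[x y] _ <-] /=.
rewrite mE.
have [alt|agt|/eqP] := ltgtP a 0; last by rewrite (negbTE a0).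
(* A negative slope exchanges the endpoints, and with them the open and the closed end. *)
- rewrite [X in (_ * _ X)%E](_ : _ = `[(y - b) / a, (x - b) / a[%classic).
    rewrite !lebesgue_measure_itv /= !lte_fin ltr_nM2r ?invr_lt0// ltrD2r.
    case: ifPn => // _; last by rewrite mule0.
    by rewrite -!EFinD -EFinM ltr0_norm//; congr (_%:E); field.
  apply/seteqP; split => z /=; rewrite !in_itv /= => /andP[h1 h2]; apply/andP.
    by split; [rewrite ler_ndivrMr|rewrite ltr_ndivlMr]; lra.
  by move: h1 h2; rewrite ler_ndivrMr// ltr_ndivlMr// => h1 h2; split; lra.
- rewrite [X in (_ * _ X)%E](_ : _ = `](x - b) / a, (y - b) / a]%classic).
    rewrite !lebesgue_measure_itv /= !lte_fin ltr_pM2r ?invr_gt0// ltrD2r.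
    case: ifPn => // _; last by rewrite mule0.
    by rewrite -!EFinD -EFinM gtr0_norm//; congr (_%:E); field.
  apply/seteqP; split => z /=; rewrite !in_itv /= => /andP[h1 h2]; apply/andP.
    by split; [rewrite ltr_pdivrMr|rewrite ler_pdivlMr]; lra.
  by move: h1 h2; rewrite ltr_pdivrMr// ler_pdivlMr// => h1 h2; split; lra.
Qed.

Lemma ge0_integral_affine (R : realType) (a b : R) (f : R -> \bar R) :
  a != 0 -> nonneg_measurable f ->
  (\int[lebesgue_measure]_x f x =
   `|a|%:E * \int[lebesgue_measure]_x f (a * x + b)%R)%E.
Proof.
move=> a0 [mf f0]; have na : 0 <= `|a| by [].
have mg : measurable_fun [set: measurableTypeR R]
    ((fun x => a * x + b) : _ -> measurableTypeR R).
  by apply: measurable_funD => //; exact: measurable_funM.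
have := @ge0_integral_pushforward _ _ _ _ _ _ mg lebesgue_measure setT f
  measurableT mf.
rewrite preimage_setT => <-; last by move=> y _.
rewrite -(ge0_integral_mscale _ _ (NngNum na))//.
apply: eq_measure_integral => A mA _.
exact: lebesgue_measure_affine.
Qed.

(** * Normal densities: change of variables, symmetry and stability *)

Section normal.
Context (R : realType).
Implicit Types (f phi : R -> \bar R) (b s t z u x : R).
Local Notation mu := (@lebesgue_measure R).

(** The Radon-Nikodym derivative and the explicit density have the same integral over every
    measurable set, hence agree almost everywhere. *)
Lemma ge0_integral_normal_prob b s f : nonneg_measurable f ->
  (\int[normal_prob b s]_x f x = \int[mu]_x (f x * (normal_pdf b s x)%:E))%E.
Proof.
move=> [mf f0]; have dom := normal_prob_dominates b s.
rewrite -(Radon_Nikodym_SigmaFinite.change_of_variables dom)//.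
have mRN := measurable_int _ (Radon_Nikodym_SigmaFinite.f_integrable dom).
have mpdf : measurable_fun [set: R] (fun x => (normal_pdf b s x)%:E).
  by apply/measurable_EFinP; exact: measurable_normal_pdf.
apply: ae_eq_integral => //.
- exact: emeasurable_funM.
- exact: emeasurable_funM.
- apply: ae_eqe_mul2l; apply: integral_ae_eq => //.
    exact: Radon_Nikodym_SigmaFinite.f_integrable.
  by move=> E _ mE; rewrite -Radon_Nikodym_SigmaFinite.f_integral.
Qed.

Lemma normal_peakE s : normal_peak s = `|s|^-1 * normal_peak 1.
Proof.
rewrite /normal_peak -mulrnAr sqrtrM ?sqr_ge0// sqrtr_sqr invfM.
by rewrite expr1n mul1r.
Qed.

Lemma normal_pdf_affine b s z : s != 0 ->
  normal_pdf b s (s * z + b) * `|s| = normal_pdf 0 1 z.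
Proof.
move=> s0; rewrite !normal_pdfE// ?oner_neq0//.
rewrite (normal_peakE s) /normal_fun subr0 addrK.
rewrite (_ : - (s * z) ^+ 2 / (s ^+ 2 *+ 2) = - z ^+ 2 / (1 ^+ 2 *+ 2)); last by field.
have ns0 : `|s| != 0 by rewrite normr_eq0.
by field.
Qed.

Lemma normal_integral_affine b s phi : s != 0 -> nonneg_measurable phi ->
  (\int[normal_prob 0 1]_z phi (s * z + b)%R =
   \int[mu]_u (phi u * (normal_pdf b s u)%:E))%E.
Proof.
move=> s0 [mphi phi0].
have maff : measurable_fun [set: R] (fun z => s * z + b).
  by apply: measurable_funD => //; exact: measurable_funM.
have mpdf c r : measurable_fun [set: R] (fun x => (normal_pdf c r x)%:E).
  by apply/measurable_EFinP; exact: measurable_normal_pdf.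
rewrite ge0_integral_normal_prob; last first.
  by split => //; exact: (measurableT_comp mphi maff).
rewrite [RHS](ge0_integral_affine b s0); last first.
  split; first by apply: emeasurable_funM.
  by move=> x; rewrite mule_ge0// lee_fin normal_pdf_ge0.
rewrite -ge0_integralZl//.
- apply: eq_integral => z _; rewrite -(normal_pdf_affine b z s0) EFinM.
  by rewrite muleA muleC.
- by apply: emeasurable_funM; [exact: (measurableT_comp mphi maff)|
    exact: (measurableT_comp (mpdf b s) maff)].
- by move=> z _; rewrite mule_ge0// lee_fin normal_pdf_ge0.
Qed.

(** For [s != 0] both sides become integrals of [phi] against the centered density of scale [s],
    which depends on [s] only through [|s|]. *)
Lemma normal_integral_abs s phi : nonneg_measurable phi ->
  (\int[normal_prob 0 1]_z phi (s * z)%R =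
   \int[normal_prob 0 1]_z phi (`|s| * z)%R)%E.
Proof.
move=> hphi; have [->|s0] := eqVneq s 0; first by rewrite normr0.
have ns0 : `|s| != 0 by rewrite normr_eq0.
have := normal_integral_affine 0 s0 hphi; have := normal_integral_affine 0 ns0 hphi.
under eq_integral do rewrite addr0; move=> ->.
under eq_integral do rewrite addr0; move=> ->.
apply: eq_integral => u _; congr (_ * _%:E)%E.
by rewrite !normal_pdfE// (normal_peakE s) (normal_peakE `|s|) normr_id
  /normal_fun real_normK ?num_real.
Qed.

(* Completing the square. *)
Lemma normal_pdf_convolution s t z u : s != 0 -> t != 0 ->
  let r := Num.sqrt (s ^+ 2 + t ^+ 2) in
  normal_pdf (s * z) t u * normal_pdf 0 1 z =
  normal_pdf 0 r u * normal_pdf (s * u / r ^+ 2) (t / r) z.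
Proof.
move=> s0 t0 r.
have r2 : r ^+ 2 = s ^+ 2 + t ^+ 2 by rewrite sqr_sqrtr// addr_ge0 ?sqr_ge0.
have st0 : s ^+ 2 + t ^+ 2 != 0.
  by rewrite gt_eqF// ltr_wpDl ?sqr_ge0// exprn_even_gt0.
have r0 : r != 0 by apply: contra_neq st0 => r_eq0; rewrite -r2 r_eq0 expr0n.
have rp : 0 <= r by exact: sqrtr_ge0.
rewrite !normal_pdfE ?oner_neq0// ?mulf_neq0 ?invr_neq0//.
rewrite (normal_peakE t) (normal_peakE r) (normal_peakE (t / r)).
rewrite normf_div (ger0_norm rp) /normal_fun.
have -> : forall a b c e : R, a^-1 * b * c * (b * e) = a^-1 * b ^+ 2 * (c * e).
  by move=> *; ring.
rewrite -expRD.
have nt0 : `|t| != 0 by rewrite normr_eq0.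
rewrite [RHS](_ : _ = `|t|^-1 * normal_peak 1 ^+ 2 *
  (expR (- (u - 0) ^+ 2 / (r ^+ 2 *+ 2)) *
   expR (- (z - s * u / r ^+ 2) ^+ 2 / ((t / r) ^+ 2 *+ 2)))); last by field; rewrite r0 nt0.
rewrite -expRD; congr (_ * expR _).
rewrite [X in _ = _ + X](_ : _ =
    - (z - s * u / r ^+ 2) ^+ 2 * r ^+ 2 / (t ^+ 2 *+ 2)); last by field; rewrite r0 t0.
by rewrite r2; field; rewrite st0 t0.

Qed.

(** After Tonelli, [normal_pdf_convolution] writes the joint density as the density of the sum [u]
    times the conditional density of [z] given [u], which integrates to one. When [s] or [t]
    vanishes there is no density to convolve, and the symmetry of the law takes over. *)
Lemma normal_convolution s t phi : nonneg_measurable phi ->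
  (\int[normal_prob 0 1]_z \int[normal_prob 0 1]_z' phi (s * z + t * z')%R =
   \int[normal_prob 0 1]_z phi (Num.sqrt (s ^+ 2 + t ^+ 2) * z)%R)%E.
Proof.
move=> hphi; have [->|s0] := eqVneq s 0.
  rewrite expr0n /= add0r sqrtr_sqr -normal_integral_abs//.
  under eq_integral do under eq_integral do rewrite mul0r add0r.
  by rewrite integral_cst//= probability_setT mule1.
have [->|t0] := eqVneq t 0.
  rewrite [in RHS]expr0n /= addr0 sqrtr_sqr -normal_integral_abs//.
  apply: eq_integral => z _.
  under eq_integral do rewrite mul0r addr0.
  by rewrite integral_cst//= probability_setT mule1.
have [mphi phi0] := hphi.
set r := Num.sqrt _.
have r0 : r != 0.
  rewrite sqrtr_eq0 -ltNge ltr_wpDl ?sqr_ge0//.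
  by rewrite exprn_even_gt0.
pose F (p : R * R) : \bar R :=
  (phi p.2 * (normal_pdf (s * p.1) t p.2)%:E * (normal_pdf 0 1 p.1)%:E)%E.
have F0 p : (0 <= F p)%E by rewrite /F !mule_ge0// lee_fin normal_pdf_ge0.
have mF : measurable_fun [set: R * R] F.
  apply: emeasurable_funM; last first.
    apply/measurable_EFinP.
    exact: (measurableT_comp (measurable_normal_pdf _ _) measurable_fst).
  apply: emeasurable_funM.
    exact: (measurableT_comp mphi measurable_snd).
  apply/measurable_EFinP; rewrite /normal_pdf (negbTE t0).
  apply: measurable_funM => //; apply: measurableT_comp => //.
  apply: measurable_funM => //; apply: measurableT_comp => //.
  apply: measurable_funX; apply: measurable_funB => //.
  exact: measurable_funM.
transitivity (\int[mu]_z \int[mu]_u F (z, u))%E.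
  rewrite ge0_integral_normal_prob; last first.
    split; last by move=> z; apply: integral_ge0 => z' _.
    pose G (p : R * R) : \bar R := phi (s * p.1 + t * p.2).
    have mG : measurable_fun setT G.
      apply: (measurableT_comp mphi).
      by apply: measurable_funD; exact: measurable_funM.
    exact: (measurable_fun_fubini_tonelli_F (m2 := normal_prob 0 1) G mG
      (fun=> phi0 _)).
  apply: eq_integral => z _.
  under eq_integral do rewrite addrC.
  rewrite normal_integral_affine// -ge0_integralZr//.
  - apply: emeasurable_funM => //; apply/measurable_EFinP.
    exact: measurable_normal_pdf.
  - by move=> u _; rewrite mule_ge0// lee_fin normal_pdf_ge0.
  - by rewrite lee_fin normal_pdf_ge0.
apply: (etrans (fubini_tonelli (m1 := mu) (m2 := mu) F mF F0)).
transitivity (\int[mu]_u (phi u * (normal_pdf 0 r u)%:E))%E.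
  apply: eq_integral => u _; rewrite /F /=.
  under eq_integral do rewrite -muleA -EFinM normal_pdf_convolution// EFinM muleA.
  rewrite ge0_integralZl//; last 3 first.
  - by apply/measurable_EFinP; exact: measurable_normal_pdf.
  - by move=> z _; rewrite lee_fin normal_pdf_ge0.
  - by rewrite mule_ge0// lee_fin normal_pdf_ge0.
  by rewrite integral_normal_pdf mule1.
have := normal_integral_affine 0 r0 hphi.
by under eq_integral do rewrite addr0; move=> ->.
Qed.

End normal.

(** * Moments of the standard normal law, by comparing densities of different scales *)

Section normal_moments.
Context (R : realType).
Implicit Types (s z : R).
Local Notation mu := (@lebesgue_measure R).
Local Notation N := (normal_prob (0 : R) 1).

Let mpdf (b s : R) : measurable_fun [set: R] (fun x => (normal_pdf b s x)%:E).
Proof. by apply/measurable_EFinP; exact: measurable_normal_pdf. Qed.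

Let mpdf' (b s : R) :
  measurable_fun [set: measurableTypeR R] (fun x => (normal_pdf b s x)%:E).
Proof. exact: mpdf. Qed.

Let pdf0 (b s x : R) : (0 <= (normal_pdf b s x)%:E)%E.
Proof. by rewrite lee_fin normal_pdf_ge0. Qed.

Lemma nonneg_measurable_exprn2 n : nonneg_measurable (fun z : R => (z ^+ n.*2)%:E).
Proof.
split; first by apply/measurable_EFinP; exact: measurable_funX.
by move=> z; rewrite lee_fin -mul2n mulnC exprM sqr_ge0.
Qed.

(** The ratio of two centered normal densities is an exponential of [z ^+ 2]. Bounding that
    exponential below by polynomials extracts moments from the sole fact that densities integrate to
    one. *)
Lemma normal_pdf1E s z : s != 0 ->
  normal_pdf 0 1 z * expR ((1 - s ^- 2) * z ^+ 2 / 2) = `|s| * normal_pdf 0 s z.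
Proof.
move=> s0; rewrite !normal_pdfE ?oner_neq0// (normal_peakE s) /normal_fun.
have ns0 : `|s| != 0 by rewrite normr_eq0.
rewrite -[LHS]mulrA -expRD [RHS]mulrA [in RHS]mulrA mulfV// mul1r.
by congr (_ * expR _); field.
Qed.

Lemma normal_fourth_moment_lty : (\int[N]_z (z ^+ 4)%:E < +oo)%E.
Proof.
rewrite ge0_integral_normal_prob; last exact: (nonneg_measurable_exprn2 2).
(* At scale 2 the ratio is exp(3/8 z^2), the square of exp(3/16 z^2), hence at least (3/16)^2 z^4.
   The constant 57 rounds up 2 (16/3)^2. *)
apply: (@le_lt_trans _ _ (\int[mu]_z (57%:E * (normal_pdf 0 2 z)%:E))%E); last first.
  rewrite ge0_integralZl//.
  by rewrite integral_normal_pdf mule1 ltry.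
apply: ge0_le_integral => //.
- by move=> z _; rewrite mule_ge0//; exact: (nonneg_measurable_exprn2 2).2.
- apply: emeasurable_funM => //.
  exact: (nonneg_measurable_exprn2 2).1.
- by apply: emeasurable_funM.
- move=> z _; rewrite -!EFinM lee_fin.
  have two0 : (2 : R) != 0 by [].
  have := normal_pdf1E z two0; rewrite ger0_norm// => E2.
  rewrite (_ : 57 * normal_pdf 0 2 z = 57 / 2 * (2 * normal_pdf 0 2 z)); last by field.
  rewrite -E2.
  rewrite (_ : (1 - 2 ^- 2) * z ^+ 2 / 2 = (3 / 16 * z ^+ 2) + (3 / 16 * z ^+ 2)); last by field.
  rewrite expRD mulrCA mulrC; apply: ler_wpM2l; first exact: normal_pdf_ge0.
  have h := expR_ge1Dx (3 / 16 * z ^+ 2).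
  have z2 : 0 <= z ^+ 2 by rewrite sqr_ge0.
  have : (3 / 16 * z ^+ 2) * (3 / 16 * z ^+ 2) <=
      expR (3 / 16 * z ^+ 2) * expR (3 / 16 * z ^+ 2).
    by rewrite ler_pM//; lra.
  have -> : z ^+ 4 = z ^+ 2 * z ^+ 2 by ring.
  have : 0 <= z ^+ 2 * z ^+ 2 by rewrite mulr_ge0.
  by set a := z ^+ 2; set e := expR _ => h1 h2; lra.
Qed.

(** From exp(a) >= 1 + a, the density ratio at scale s gives 1 + (1 - s^-2) M / 2 <= s for every s >
    0. The choice s = sqrt M turns this into (sqrt M - 1)^2 <= 0. *)
Lemma normal_second_moment : (\int[N]_z (z ^+ 2)%:E = 1)%E.
Proof.
have nm2 := nonneg_measurable_exprn2 1; rewrite -[1.*2]/2%N in nm2.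
set M := (\int[N]_z _)%E.
have M0 : (0 <= M)%E by apply: integral_ge0 => z _; exact: nm2.2.
have Mfin : M \is a fin_num.
  rewrite ge0_fin_numE//.
  apply: (@le_lt_trans _ _ (\int[N]_z (1 + (z ^+ 4)%:E))%E).
    apply: ge0_le_integral => //.
    - by move=> z _; exact: nm2.2.
    - exact: nm2.1.
    - by apply: emeasurable_funD => //; exact: (nonneg_measurable_exprn2 2).1.
    - move=> z _; rewrite lee_fin.
      have -> : z ^+ 4 = z ^+ 2 * z ^+ 2 by ring.
      by set a := z ^+ 2; nra.
  rewrite ge0_integralD//.
  - rewrite integral_cst//= probability_setT mul1e.
    by rewrite lte_add_pinfty ?ltry//; exact: normal_fourth_moment_lty.
  - by move=> z _; exact: (nonneg_measurable_exprn2 2).2.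
  - exact: (nonneg_measurable_exprn2 2).1.
pose v z : \bar R := ((z ^+ 2)%:E * (normal_pdf 0 1 z)%:E)%E.
have mv : measurable_fun [set: measurableTypeR R] v.
  by apply: emeasurable_funM => //; exact: nm2.1.
have v0 z : (0 <= v z)%E by rewrite mule_ge0//; exact: nm2.2.
have intv c : 0 <= c -> (\int[mu]_z (c%:E * v z) = c%:E * M)%E.
  by move=> c0; rewrite ge0_integralZl// /M ge0_integral_normal_prob.
have intp c s : 0 <= c -> (\int[mu]_z (c%:E * (normal_pdf 0 s z)%:E) = c%:E)%E.
  by move=> c0; rewrite ge0_integralZl// integral_normal_pdf mule1.
have mZ c (h : R -> \bar R) : measurable_fun [set: measurableTypeR R] h ->
    measurable_fun [set: measurableTypeR R] (fun z => c%:E * h z)%E.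
  by move=> mh; apply: emeasurable_funM.
(* The term in [s ^- 2] is moved to the right, so that both sides are integrals of nonnegative
   functions. *)
have key s : 0 < s -> 1 + 2^-1 * fine M <= s + s ^- 2 / 2 * fine M.
  move=> s0; have s2 : 0 <= s ^- 2 / 2 by rewrite divr_ge0// invr_ge0 exprn_ge0// ltW.
  rewrite -lee_fin !EFinD !EFinM fineK// -EFinM.
  have s0' := ltW s0.
  rewrite -(intp 1 1)// -(intp s s)// -!intv//.
  have h0 c a : 0 <= c -> (0 <= c%:E * (normal_pdf 0 a (_ : R))%:E)%E.
    by move=> c0; rewrite mule_ge0.
  rewrite -!ge0_integralD//; first last.
  all: try by [apply: mZ | move=> z _; rewrite mule_ge0// lee_fin].
  apply: ge0_le_integral => //.
  - by move=> z _; rewrite adde_ge0// mule_ge0// lee_fin.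
  - by apply: emeasurable_funD; exact: mZ.
  - by apply: emeasurable_funD; exact: mZ.
  - move=> z _; rewrite /v -!EFinM -!EFinD lee_fin.
    have sn0 : s != 0 by rewrite gt_eqF.
    have := normal_pdf1E z sn0; rewrite (gtr0_norm s0) => <-.
    have := expR_ge1Dx ((1 - s ^- 2) * z ^+ 2 / 2).
    have := normal_pdf_ge0 0 1 z.
    set q := normal_pdf 0 1 z; set e := expR _; set a := z ^+ 2; set b := s ^- 2.
    by move=> q0 he; nra.
suff m1 : fine M = 1 by rewrite -(fineK Mfin) m1.
have : 0 <= fine M by exact: fine_ge0.
set m := fine M in key *; rewrite le_eqVlt => /predU1P[m0|m0].
  (* Scale 1/2 excludes a zero second moment, as it would give 1 <= 1/2. *)
  have h2 : 0 < 2^-1 :> R by rewrite invr_gt0.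
  by have := key _ h2; rewrite -m0; lra.
have sm : 0 < Num.sqrt m by rewrite sqrtr_gt0.
have := key _ sm.
have -> : Num.sqrt m ^- 2 / 2 * m = 2^-1.
  by rewrite sqr_sqrtr ?ltW//; field; rewrite gt_eqF.
have := sqr_sqrtr (ltW m0); set r := Num.sqrt m => <- h.
have : (r - 1) ^+ 2 <= 0 by nra.
rewrite le_eqVlt ltNge sqr_ge0 orbF sqrf_eq0 subr_eq0 => /eqP ->.
by rewrite expr1n.
Qed.

(** By symmetry the positive and negative parts have equal integrals. These are finite, being
    dominated by 1 + (s z)^2, so their difference is a genuine zero. *)
Lemma normal_mean s : (\int[N]_z (s * z)%:E = 0)%E.
Proof.
have mE : measurable_fun [set: R] (EFin : R -> \bar R) by apply/measurable_EFinP.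
have mp := measurable_funepos mE.
have nmp : nonneg_measurable ((EFin : R -> \bar R)^\+)%E.
  by split => // x; exact: funepos_ge0.
rewrite integralE.
have -> : (\int[N]_z (fun z => (s * z)%:E)^\+ z =
    \int[N]_z (EFin : R -> \bar R)^\+ (s * z)%R)%E.
  by apply: eq_integral => z _; rewrite !funeposE.
have -> : (\int[N]_z (fun z => (s * z)%:E)^\- z =
    \int[N]_z (EFin : R -> \bar R)^\+ (s * z)%R)%E.
  rewrite normal_integral_abs// -normrN -normal_integral_abs//.
  by apply: eq_integral => z _; rewrite mulNr funeposE funenegE.
rewrite subee// ge0_fin_numE; last first.
  by apply: integral_ge0 => z _; exact: funepos_ge0.
have nm2 := nonneg_measurable_exprn2 1; rewrite -[1.*2]/2%N in nm2.
have s2 : 0 <= s ^+ 2 by exact: sqr_ge0.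
apply: (@le_lt_trans _ _ (\int[N]_z (1 + (s ^+ 2)%:E * (z ^+ 2)%:E))%E).
  apply: ge0_le_integral => //.
  - by apply: (measurableT_comp mp); exact: measurable_funM.
  - by apply: emeasurable_funD => //; apply: emeasurable_funM => //; exact: nm2.1.
  - move=> z _; rewrite funeposE -EFin_max -EFinM -EFinD lee_fin ge_max -exprMn.
    apply/andP; split; last by rewrite addr_ge0 ?sqr_ge0.
    by have := sqr_ge0 (s * z - 1); nra.
rewrite ge0_integralD//; last 2 first.
- by move=> z _; rewrite mule_ge0//; exact: nm2.2.
- by apply: emeasurable_funM => //; exact: nm2.1.
rewrite ge0_integralZl//; last 2 first.
- exact: nm2.1.
- by move=> z _; exact: nm2.2.
by rewrite integral_cst//= probability_setT mul1e normal_second_moment mule1 -EFinD ltry.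
Qed.

End normal_moments.

(** * Gaussian vectors *)

Section normal_direction.
Context (R : realType) (d : nat).
Implicit Types (a : borel_rV R d) (g : borel_rV R d -> \bar R) (s t : R).
Local Notation N := (normal_prob (0 : R) 1).

(** Averaging along a fixed direction is a one-dimensional normal integral, so a Gaussian vector can
    be treated column by column with no multivariate density. *)
Definition normal_avg a s g : borel_rV R d -> \bar R :=
  avg N (fun z => (s * z) *: a) g.

Lemma measurable_scale_dir a s :
  measurable_fun [set: R] (fun z : R => (s * z) *: a : borel_rV R d).
Proof.
by apply: (measurable_funZ_rV _ (measurable_cst a)); exact: measurable_funM.
Qed.

Lemma nonneg_measurable_normal_avg a s g :
  nonneg_measurable g -> nonneg_measurable (normal_avg a s g).
Proof. by apply: nonneg_measurable_avg; exact: measurable_scale_dir. Qed.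

Lemma normal_avg_add a s t g : nonneg_measurable g ->
  normal_avg a s (normal_avg a t g) = normal_avg a (Num.sqrt (s ^+ 2 + t ^+ 2)) g.
Proof.
move=> hg; apply/funext => x.
pose phi (u : R) := g (x + u *: a).
have hphi : nonneg_measurable phi.
  split => [|u]; last exact: hg.2.
  apply: (measurableT_comp hg.1).
  apply: (measurable_funD_rV (measurable_cst (x : borel_rV R d))).
  exact: (measurable_funZ_rV _ (measurable_cst a)).
rewrite /normal_avg /avg -[RHS](normal_convolution s t hphi).
apply: eq_integral => z _; apply: eq_integral => z' _.
by rewrite /phi scalerDl addrA.
Qed.

Lemma normal_avg_chain_comm (J : Type) (a : J -> borel_rV R d) (L : seq J) b s t g :
  nonneg_measurable g ->
  foldr (fun j => normal_avg (a j) s) (normal_avg b t g) L =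
  normal_avg b t (foldr (fun j => normal_avg (a j) s) g L).
Proof.
move=> hg; elim: L => //= j L ->.
apply: avg_comm; [exact: measurable_scale_dir..|].
apply: nonneg_measurable_foldr => // i h; exact: nonneg_measurable_normal_avg.
Qed.

(** Commutation brings the two averages along each [a j] next to each other, where they merge. *)
Lemma normal_avg_chain_add (J : Type) (a : J -> borel_rV R d) (L : seq J) s t g :
  nonneg_measurable g ->
  foldr (fun j => normal_avg (a j) s) (foldr (fun j => normal_avg (a j) t) g L) L =
  foldr (fun j => normal_avg (a j) (Num.sqrt (s ^+ 2 + t ^+ 2))) g L.
Proof.
move=> hg.
have nmf r L' h : nonneg_measurable h ->
    nonneg_measurable (foldr (fun j => normal_avg (a j) r) h L').
  by apply: nonneg_measurable_foldr => j k; exact: nonneg_measurable_normal_avg.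
elim: L => //= j L IH.
by rewrite normal_avg_chain_comm ?normal_avg_add ?IH//; repeat exact: nmf.
Qed.

(** A linear form sees each direction as a centered normal contribution [lin (a j) * z], and
    successive contributions merge by convolution. This gives the one-dimensional marginals of the
    Gaussian vector, hence its moments. *)
Lemma normal_avg_linear (J : Type) (a : J -> borel_rV R d) (L : seq J)
    (v : 'I_d -> R) (phi : R -> \bar R) (x : borel_rV R d) :
  nonneg_measurable phi ->
  let lin (y : borel_rV R d) := \sum_(i < d) v i * rv_val y 0 i in
  foldr (fun j => normal_avg (a j) 1) (phi \o lin) L x =
  (\int[N]_z phi (lin x + Num.sqrt (\sum_(j <- L) lin (a j) ^+ 2) * z)%R)%E.
Proof.
move=> hphi lin.
have linD y y' : lin (y + y') = lin y + lin y'.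
  by rewrite /lin -big_split; apply: eq_bigr => i _; rewrite /= /rv_val mxE mulrDr.
have linZ c y : lin (c *: y) = c * lin y.
  rewrite /lin mulr_sumr; apply: eq_bigr => i _; rewrite /= /rv_val mxE.
  by rewrite mulrCA.
elim: L x => [|j L IH] x /=.
  under eq_integral do rewrite big_nil sqrtr0 mul0r addr0.
  by rewrite integral_cst//= probability_setT mule1.
rewrite /normal_avg /avg.
pose psi u := phi (lin x + u).
have hpsi : nonneg_measurable psi.
  split => [|u]; last exact: hphi.2.
  by apply: (measurableT_comp hphi.1); exact: measurable_funD.
set r := Num.sqrt (\sum_(i <- L) lin (a i) ^+ 2).
transitivity (\int[N]_z \int[N]_z' psi (lin (a j) * z + r * z')%R)%E.
  apply: eq_integral => z _; rewrite IH; apply: eq_integral => z' _.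
  by rewrite /psi linD linZ mul1r addrA [z * _]mulrC.
rewrite normal_convolution//; apply: eq_integral => z _.
by rewrite /psi big_cons sqr_sqrtr// sumr_ge0// => i _; rewrite sqr_ge0.
Qed.

End normal_direction.

Section gaussian.
Context (R : realType) (d l : nat) (dU : measure_display) (U : measurableType dU)
  (Q : probability U R) (A : 'M[R]_(d, l)) (Z : 'I_l -> {RV Q >-> R}).
Hypothesis indZ : mutually_independent Z.
Hypothesis lawZ : forall (j : 'I_l) (B : set R), measurable B ->
  distribution Q (Z j) B = normal_prob 0 1 B.
Implicit Types (g : borel_rV R d -> \bar R).
Local Notation N := (normal_prob (0 : R) 1).

Let a (j : 'I_l) : borel_rV R d := (col j A)^T.

(** The vector [A Z] itself, with which [xi] agrees only almost surely. *)
Definition gaussian_comb (w : U) : borel_rV R d :=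
  \sum_(j < l) Z j w *: (col j A)^T.

Lemma gaussian_combE w i : rv_val (gaussian_comb w) 0 i = \sum_(j < l) A i j * Z j w.
Proof.
rewrite /rv_val /gaussian_comb summxE; apply: eq_bigr => j _.
by rewrite !mxE mulrC.
Qed.

Lemma measurable_gaussian_comb : measurable_fun [set: U] gaussian_comb.
Proof.
have mu j : measurable_fun [set: R] (fun z : R => z *: a j : borel_rV R d).
  exact: (measurable_funZ_rV _ (measurable_cst (a j))).
exact: (@measurable_sum_rV _ d _ _ _ _ Q _ Z _ mu (index_enum 'I_l)).
Qed.

(** Independence of the [Z j] splits the average column by column, and their law turns each factor
    into a normal integral on the line. *)
Lemma avg_gaussian_comb h g : nonneg_measurable g ->
  avg Q (fun w => h *: gaussian_comb w) g =
  foldr (fun j => normal_avg (a j) h) g (index_enum 'I_l).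
Proof.
move=> hg; apply/funext => x.
have mu j : measurable_fun [set: R] (fun z : R => (h * z) *: a j : borel_rV R d).
  exact: measurable_scale_dir.
have := integral_independent_sum indZ mu x (index_enum_uniq _) hg.
rewrite /avg => h0; transitivity
    (\int[Q]_w g (x + \sum_(i <- index_enum 'I_l) (h * Z i w) *: a i)%R)%E.
  apply: eq_integral => w _; rewrite /gaussian_comb scaler_sumr.
  by congr (g (x + _)); apply: eq_bigr => i _; rewrite scalerA.
rewrite h0; elim: (index_enum _) x {h0} => //= j L IH x.
rewrite /normal_avg /avg.
have nmL : nonneg_measurable (foldr (fun j => normal_avg (a j) h) g L).
  by apply: nonneg_measurable_foldr => // i k; exact: nonneg_measurable_normal_avg.
under eq_integral do rewrite IH.
have mg := measurable_shift x (mu j) nmL.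
have mZ : @measurable_fun _ _ U (measurableTypeR R) setT (Z j).
  have mZ0 : measurable_fun [set: U] (Z j : U -> R) by exact: measurable_funP.
  exact: mZ0.
have := @ge0_integral_pushforward _ _ _ _ _ _ mZ Q setT _ measurableT mg.
rewrite preimage_setT /comp => <-; last by move=> z _; exact: nmL.2.
by apply: eq_measure_integral => B mB _; exact: lawZ.
Qed.

(** Stability, stated for operators: in each column direction one more step adds variances, h^2 n +
    h^2 = h^2 (n + 1). *)
Lemma iter_avg_gaussian_comb h n g x : 0 <= h -> nonneg_measurable g ->
  iter n (avg Q (fun w => h *: gaussian_comb w)) g x =
  avg Q (fun w => (h * Num.sqrt n%:R) *: gaussian_comb w) g x.
Proof.
move=> h0 hg; elim: n x => [|n IH] x /=.
  rewrite sqrtr0 mulr0 /avg; under eq_integral do rewrite scale0r addr0.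
  by rewrite integral_cst//= probability_setT mule1.
rewrite (_ : iter n _ g = avg Q (fun w => (h * Num.sqrt n%:R) *: gaussian_comb w) g);
  last exact/funext.
rewrite avg_gaussian_comb; last first.
  apply: nonneg_measurable_avg => //.
  exact: (measurable_funZ_rV (measurable_cst _) measurable_gaussian_comb).
rewrite !avg_gaussian_comb// normal_avg_chain_add//.
congr (foldr _ _ _ _); apply/funext => j; congr normal_avg.
rewrite exprMn sqr_sqrtr// -{1}[h ^+ 2]mulr1 -mulrDr nat1r.
by rewrite sqrtrM ?sqr_ge0// sqrtr_sqr ger0_norm.
Qed.

Lemma integral_gaussian_linear (v : 'I_d -> R) (phi : R -> \bar R) :
  nonneg_measurable phi ->
  (\int[Q]_w phi (\sum_(i < d) v i * rv_val (gaussian_comb w) 0 i)%R =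
   \int[N]_z phi (Num.sqrt (\sum_(j < l) (\sum_(i < d) v i * A i j) ^+ 2) * z)%R)%E.
Proof.
move=> hphi.
pose lin (y : borel_rV R d) := \sum_(i < d) v i * rv_val y 0 i.
have hg : nonneg_measurable (phi \o lin).
  split => [|y]; last exact: hphi.2.
  apply: (measurableT_comp hphi.1); apply: measurable_sum => i.
  by apply: measurable_funM => //; exact: measurable_coord.
have := congr1 (@^~ 0) (avg_gaussian_comb 1 hg).
rewrite /avg normal_avg_linear//= => h.
transitivity (\int[Q]_w phi (lin (0 + 1 *: gaussian_comb w)%R))%E.
  by apply: eq_integral => w _; rewrite add0r scale1r.
rewrite h; apply: eq_integral => z _.
rewrite (_ : \sum_(i < d) _ = 0) ?add0r; last first.
  by apply: big1 => i _; rewrite /rv_val mxE mulr0.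
congr (phi (Num.sqrt _ * z)); apply: eq_bigr => j _; congr (_ ^+ 2).
by apply: eq_bigr => i _; rewrite /rv_val !mxE.
Qed.

End gaussian.

(** * Taylor expansion along coordinates *)

Section taylor1.
Context (R : realType).
Implicit Types (phi : R -> R) (t K : R).

(** The derivative is bounded only up to [|t|], so that remainders which grow with [x] can be fed
    back as derivative bounds. *)
Lemma mean_value_bound phi dphi K t :
  (forall x : R, is_derive x 1 phi (dphi x)) ->
  (forall x, `|x| <= `|t| -> `|dphi x| <= K) ->
  `|phi t - phi 0| <= K * `|t|.
Proof.
move=> hphi hK.
have cphi a b : {within `[a, b], continuous phi}.
  apply: derivable_within_continuous => x _.
  exact: ex_derive.
have [t0|t0|->] := ltgtP t 0; last by rewrite subrr !normr0 mulr0.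
- have [c] := MVT t0 (fun x _ => hphi x) (cphi t 0).
  rewrite in_itv /= => /andP[tc c0] h.
  rewrite distrC h sub0r normrM normrN ler_wpM2r// hK//.
  by rewrite !ltr0_norm// lerN2 ltW.
- have [c] := MVT t0 (fun x _ => hphi x) (cphi 0 t).
  rewrite in_itv /= => /andP[c0 ct] h.
  rewrite h subr0 normrM ler_wpM2r// hK//.
  by rewrite !gtr0_norm// ltW.
Qed.

(** Removing the linear part leaves the derivative [dphi x - dphi 0], at most [K * |t|] on the
    segment. A factor 1/2 is given up. *)
Lemma taylor1_bound phi dphi ddphi K t :
  (forall x : R, is_derive x 1 phi (dphi x)) ->
  (forall x : R, is_derive x 1 dphi (ddphi x)) ->
  (forall x, `|ddphi x| <= K) ->
  `|phi t - phi 0 - t * dphi 0| <= K * `|t| ^+ 2.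
Proof.
move=> h1 h2 hK.
pose u x := phi x - dphi 0 * x.
have hu (x : R) : is_derive x 1 u (dphi x - dphi 0).
  have -> : u = phi - dphi 0 \*: id by [].
  by apply: is_derive_eq; rewrite /GRing.scale /= mulr1.
have := @mean_value_bound u _ (K * `|t|) t hu.
have -> : K * `|t| * `|t| = K * `|t| ^+ 2 by ring.
have -> : u t - u 0 = phi t - phi 0 - t * dphi 0.
  by rewrite /u; ring.
apply => x xt.
have K0 : 0 <= K by apply: le_trans (hK 0).
rewrite (le_trans (mean_value_bound (t := x) h2 (fun y _ => hK y)))//.
by rewrite ler_wpM2l.
Qed.

Lemma taylor2_bound phi dphi ddphi d3phi K t :
  (forall x : R, is_derive x 1 phi (dphi x)) ->
  (forall x : R, is_derive x 1 dphi (ddphi x)) ->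
  (forall x : R, is_derive x 1 ddphi (d3phi x)) ->
  (forall x, `|d3phi x| <= K) ->
  `|phi t - phi 0 - t * dphi 0 - t ^+ 2 / 2 * ddphi 0| <= K * `|t| ^+ 3.
Proof.
move=> h1 h2 h3 hK.
pose u x := phi x - dphi 0 * x - ddphi 0 / 2 * x ^+ 2.
have hu (x : R) : is_derive x 1 u (dphi x - dphi 0 - x * ddphi 0).
  have -> : u = phi - dphi 0 \*: id - (ddphi 0 / 2) \*: (id ^+ 2) by [].
  by apply: is_derive_eq; rewrite /GRing.scale /= expr1; field.
have := @mean_value_bound u _ (K * `|t| ^+ 2) t hu.
have -> : K * `|t| ^+ 2 * `|t| = K * `|t| ^+ 3 by ring.
have -> : u t - u 0 = phi t - phi 0 - t * dphi 0 - t ^+ 2 / 2 * ddphi 0.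
  by rewrite /u; field.
apply => x xt; have K0 : 0 <= K by apply: le_trans (hK 0).
rewrite (le_trans (taylor1_bound x h2 h3 hK))//.
by rewrite ler_wpM2l// lerXn2r ?nnegrE.
Qed.

End taylor1.

Section taylor.
Context (R : realType) (d : nat).
Implicit Types (g : 'rV[R]_d -> R) (x y h : 'rV[R]_d) (i j k : 'I_d) (K eta : R).
Local Notation e i := (delta_mx 0 i : 'rV[R]_d).
Local Notation "''d_' i g" := (fun x => 'D_(e i) g x) (at level 10, i at level 2, g at level 9).

(** Along a coordinate line the difference quotients are those of the partial derivative, so
    one-variable calculus applies there. *)
Lemma is_derive_line g y i (t : R) :
  (forall x, derivable g x (e i)) ->
  is_derive t 1 (fun s : R => g (y + s *: e i)) ('D_(e i) g (y + t *: e i)).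
Proof.
move=> dg.
have E : (fun h : R => h^-1 *: (((fun s : R => g (y + s *: e i)) \o shift t) (h *: 1) -
            g (y + t *: e i))) =
         (fun h : R => h^-1 *: ((g \o shift (y + t *: e i)) (h *: e i) -
            g (y + t *: e i))).
  apply/funext => s /=; congr (_ *: (g _ - _)).
  have -> : s *: (1 : R) = s by rewrite /GRing.scale /= mulr1.
  by rewrite scalerDl addrCA.
apply: DeriveDef; first by rewrite /derivable E; exact: dg.
by rewrite /derive E.
Qed.

Lemma line_bound1 g y i K (t : R) :
  (forall x, derivable g x (e i)) -> (forall x, `|'D_(e i) g x| <= K) ->
  `|g (y + t *: e i) - g y| <= K * `|t|.
Proof.
move=> dg hK.
have := mean_value_bound (t := t) (fun s => is_derive_line y s dg) (fun s _ => hK _).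
by rewrite scale0r addr0.
Qed.

Lemma line_bound2 g y i K (t : R) :
  (forall x, derivable g x (e i)) ->
  (forall x, derivable ('d_i g) x (e i)) ->
  (forall x, `|'D_(e i) ('d_i g) x| <= K) ->
  `|g (y + t *: e i) - g y - t * 'D_(e i) g y| <= K * `|t| ^+ 2.
Proof.
move=> dg ddg hK.
have := taylor1_bound t (fun s => is_derive_line y s dg)
  (fun s => is_derive_line y s ddg) (fun s => hK _).
by rewrite scale0r addr0.
Qed.

Lemma line_bound3 g y i K (t : R) :
  (forall x, derivable g x (e i)) ->
  (forall x, derivable ('d_i g) x (e i)) ->
  (forall x, derivable ('d_i ('d_i g)) x (e i)) ->
  (forall x, `|'D_(e i) ('d_i ('d_i g)) x| <= K) ->
  `|g (y + t *: e i) - g y - t * 'D_(e i) g y - t ^+ 2 / 2 * 'D_(e i) ('d_i g) y|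
    <= K * `|t| ^+ 3.
Proof.
move=> dg ddg dddg hK.
have := taylor2_bound t (fun s => is_derive_line y s dg)
  (fun s => is_derive_line y s ddg) (fun s => is_derive_line y s dddg) (fun s => hK _).
by rewrite scale0r addr0.
Qed.

(** The corners of a staircase path from 0 to [h], each leg parallel to an axis; partial derivatives
    control increments along the legs. *)
Definition head_part (m : nat) h : 'rV[R]_d := \sum_(i < d | (i < m)%N) h 0 i *: e i.

Lemma head_partS h i : head_part i.+1 h = head_part i h + h 0 i *: e i.
Proof.
rewrite /head_part (bigD1 i)//= addrC; congr (_ + _).
by apply: eq_bigl => j; rewrite ltnS ltn_neqAle andbC.
Qed.

Lemma head_part_full h : head_part d h = h.
Proof.
rewrite [RHS]row_sum_delta /head_part; apply: eq_bigl => i.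
by rewrite ltn_ord.
Qed.

Lemma head_part0 h : head_part 0 h = 0.
Proof. by rewrite /head_part big_pred0. Qed.

Lemma head_part_telescope (F : nat -> R) (E : R) m :
  F 0%N = 0 -> 0 <= E -> (m <= d)%N ->
  (forall i, (i < m)%N -> `|F i.+1 - F i| <= E) -> `|F m| <= d%:R * E.
Proof.
move=> F0 E0 md hF.
suff H n : (n <= m)%N -> `|F n| <= n%:R * E.
  by rewrite (le_trans (H m (leqnn m)))// ler_wpM2r// ler_nat.
elim: n => [_|n IH nm]; first by rewrite F0 normr0 mul0r.
rewrite -(subrK (F n) (F n.+1)) (le_trans (ler_normD _ _))//.
rewrite -natr1 mulrDl mul1r addrC lerD ?IH ?(ltnW nm)//.
exact: (hF (Ordinal (leq_trans nm md))).
Qed.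

Lemma sum_headS (F : 'I_d -> R) i :
  \sum_(j < d | (j < i.+1)%N) F j = \sum_(j < d | (j < i)%N) F j + F i.
Proof.
rewrite (bigD1 i)//= addrC; congr (_ + _).
by apply: eq_bigl => j; rewrite ltnS ltn_neqAle andbC.
Qed.

Lemma taylor0_head g x h K eta m : (m <= d)%N -> 0 <= K -> 0 <= eta ->
  (forall i, `|h 0 i| <= eta) ->
  (forall i, (i < m)%N -> forall x, derivable g x (e i)) ->
  (forall i, (i < m)%N -> forall x, `|'D_(e i) g x| <= K) ->
  `|g (x + head_part m h) - g x| <= d%:R * (K * eta).
Proof.
move=> md K0 eta0 heta dg hK.
pose F n := g (x + head_part n h) - g x.
apply: (@head_part_telescope F) => //; first by rewrite /F head_part0 addr0 subrr.
  by rewrite mulr_ge0.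
move=> i im; rewrite /F head_partS opprB addrA subrK addrA.
rewrite (le_trans (line_bound1 _ _ (dg _ im) (hK _ im)))//.
by rewrite ler_wpM2l.
Qed.

(** Leg [i] is expanded at its corner. Bringing the derivative ['d_i g] back from the corner to [x]
    is the statement of order zero for coordinates below [i]; hence the conditions [j <= i]. *)
Lemma taylor1_head g x h K eta m : (m <= d)%N -> 0 <= K -> 0 <= eta ->
  (forall i, `|h 0 i| <= eta) ->
  (forall i, (i < m)%N -> forall x, derivable g x (e i)) ->
  (forall i j, (j <= i < m)%N -> forall x, derivable ('d_i g) x (e j)) ->
  (forall i j, (j <= i < m)%N -> forall x, `|'D_(e j) ('d_i g) x| <= K) ->
  `|g (x + head_part m h) - g x - \sum_(i < d | (i < m)%N) h 0 i * 'D_(e i) g x|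
    <= d%:R * ((1 + d%:R) * (K * eta ^+ 2)).
Proof.
move=> md K0 eta0 heta dg ddg hK.
pose F n := g (x + head_part n h) - g x -
  \sum_(i < d | (i < n)%N) h 0 i * 'D_(e i) g x.
apply: (@head_part_telescope F) => //.
- by rewrite /F head_part0 addr0 subrr sub0r big_pred0 ?oppr0.
- by rewrite !mulr_ge0 ?addr_ge0 ?exprn_ge0.
move=> i im; rewrite /F head_partS sum_headS addrA.
set y := x + head_part i h; set t := h 0 i.
set S := \sum_(_ < d | _) _.
have -> : g (y + t *: e i) - g x - (S + t * 'D_(e i) g x) - (g y - g x - S) =
    (g (y + t *: e i) - g y - t * 'D_(e i) g y) +
    t * ('D_(e i) g y - 'D_(e i) g x) by ring.
rewrite (le_trans (ler_normD _ _))// mulrDl mul1r lerD//.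
- rewrite (le_trans (line_bound2 _ _ (dg _ im) (ddg i i _) (hK i i _)))//;
    rewrite ?leqnn//.
  by rewrite ler_wpM2l// lerXn2r ?nnegrE// heta.
- have := @taylor0_head ('d_i g) x h K eta i (ltnW (ltn_ord i)) K0 eta0 heta.
  rewrite normrM => H.
  have -> : d%:R * (K * eta ^+ 2) = eta * (d%:R * (K * eta)) by ring.
  rewrite ler_pM ?heta// H// => j ji z.
  + by apply: ddg; rewrite (ltnW ji).
  + by apply: hK; rewrite (ltnW ji).
Qed.

(** On leg [i], bringing ['d_i g] back to [x] by the first-order expansion creates the mixed terms
    with [j < i], and the second derivative is brought back at order zero. The summands [1],
    [d (1 + d)] and [d] are the one-variable remainder and these two errors; the outer factor [d]
    counts the legs. *)
Lemma taylor2_head g x h K eta m : (m <= d)%N -> 0 <= K -> 0 <= eta ->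
  (forall i, `|h 0 i| <= eta) ->
  (forall i, (i < m)%N -> forall x, derivable g x (e i)) ->
  (forall i j, (j <= i < m)%N -> forall x, derivable ('d_i g) x (e j)) ->
  (forall i j k, (k <= j)%N -> (j <= i < m)%N ->
    forall x, derivable ('d_j ('d_i g)) x (e k)) ->
  (forall i j k, (k <= j)%N -> (j <= i < m)%N ->
    forall x, `|'D_(e k) ('d_j ('d_i g)) x| <= K) ->
  `|g (x + head_part m h) - g x - \sum_(i < d | (i < m)%N)
      (h 0 i * 'D_(e i) g x + h 0 i ^+ 2 / 2 * 'D_(e i) ('d_i g) x +
       h 0 i * \sum_(j < d | (j < i)%N) h 0 j * 'D_(e j) ('d_i g) x)|
    <= d%:R * ((1 + d%:R * (1 + d%:R) + d%:R) * (K * eta ^+ 3)).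
Proof.
move=> md K0 eta0 heta dg ddg dddg hK.
pose c i := h 0 i * 'D_(e i) g x + h 0 i ^+ 2 / 2 * 'D_(e i) ('d_i g) x +
       h 0 i * \sum_(j < d | (j < i)%N) h 0 j * 'D_(e j) ('d_i g) x.
pose F n := g (x + head_part n h) - g x - \sum_(i < d | (i < n)%N) c i.
apply: (@head_part_telescope F) => //.
- by rewrite /F head_part0 addr0 subrr sub0r big_pred0 ?oppr0.
- by rewrite !mulr_ge0 ?addr_ge0 ?mulr_ge0 ?addr_ge0 ?exprn_ge0.
move=> i im; rewrite /F head_partS sum_headS addrA /c.
set y := x + head_part i h; set t := h 0 i.
set S := \sum_(i0 < d | (i0 < i)%N) (_ + _).
set S' := \sum_(_ < d | _) _ * _.
have -> : g (y + t *: e i) - g x -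
    (S + (t * 'D_(e i) g x + t ^+ 2 / 2 * 'D_(e i) ('d_i g) x + t * S')) -
    (g y - g x - S) =
    (g (y + t *: e i) - g y - t * 'D_(e i) g y - t ^+ 2 / 2 * 'D_(e i) ('d_i g) y) +
    t * ('D_(e i) g y - 'D_(e i) g x - S') +
    t ^+ 2 / 2 * ('D_(e i) ('d_i g) y - 'D_(e i) ('d_i g) x) by field.
have ii : (i <= i < m)%N by rewrite leqnn.
have teta : `|t| <= eta by exact: heta.
rewrite (le_trans (ler_normD _ _))// !mulrDl mul1r lerD//.
rewrite (le_trans (ler_normD _ _))// lerD//.
- rewrite (le_trans (line_bound3 _ _ (dg _ im) (ddg i i ii)
    (dddg i i i (leqnn i) ii) (hK i i i (leqnn i) ii)))//.
  by rewrite ler_wpM2l// lerXn2r ?nnegrE.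
- have := @taylor1_head ('d_i g) x h K eta i (ltnW (ltn_ord i)) K0 eta0 heta.
  rewrite normrM => H.
  have -> : d%:R * (1 + d%:R) * (K * eta ^+ 3) =
      eta * (d%:R * ((1 + d%:R) * (K * eta ^+ 2))) by ring.
  rewrite ler_pM// H//.
  + by move=> j ji z; apply: ddg; rewrite (ltnW ji).
  + by move=> j k /andP[kj ji] z; apply: dddg => //; rewrite (ltnW ji).
  + by move=> j k /andP[kj ji] z; apply: hK => //; rewrite (ltnW ji).
- have := @taylor0_head ('d_i ('d_i g)) x h K eta i (ltnW (ltn_ord i)) K0 eta0 heta.
  rewrite normrM => H.
  have -> : d%:R * (K * eta ^+ 3) = eta ^+ 2 * (d%:R * (K * eta)) by ring.
  rewrite ler_pM//.
    rewrite normrM normrX [`|2^-1|]ger0_norm ?invr_ge0//.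
    have : `|t| ^+ 2 <= eta ^+ 2 by rewrite lerXn2r ?nnegrE.
    have : 0 <= `|t| ^+ 2 by rewrite exprn_ge0.
    by rewrite /= => h1 h2; lra.
  rewrite H// => j ji z.
  + by apply: dddg => //; exact: ltnW.
  + by apply: hK => //; exact: ltnW.
Qed.

End taylor.

(** * Taylor expansion with a remainder controlled by the C^4 norm *)

Section Ck_taylor.
Context (R : realType) (d : nat).
Implicit Types (f : 'rV[R]_d -> R) (s : seq 'I_d).
Local Notation e i := (delta_mx 0 i : 'rV[R]_d).

Let leI : rel 'I_d := fun i j => (i <= j)%N.

(** A sorted word is determined by its letter counts. This identifies derivatives taken in
    increasing order with the multi-indices over which [Ck_norm] sums. *)
Lemma sorted_flatten_count s : sorted leI s ->
  flatten [seq nseq (count_mem i s) i | i <- enum 'I_d] = s.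
Proof.
move=> ss; apply: (@sorted_eq _ leI).
- by move=> j i k; exact: leq_trans.
- by move=> i j /anti_leq /val_inj.
- have : sorted leI (enum 'I_d).
    rewrite -(map_id (enum _)) sorted_map /leI.
    by have := iota_sorted 0 d; rewrite -val_enum_ord sorted_map.
  elim: (enum 'I_d) => //= i t IH it.
  have ti : all (leI i) t.
    by apply: order_path_min it => a b c; exact: leq_trans.
  have : sorted leI (flatten [seq nseq (count_mem k s) k | k <- t]).
    by apply: IH; exact: path_sorted it.
  have : all (leI i) (flatten [seq nseq (count_mem k s) k | k <- t]).
    apply/allP => k /flattenP[_ /mapP[q qt ->]] /nseqP[-> _].
    by move/allP : ti; apply.
  move: (flatten _) => r ri rs.
  elim: (count_mem i s) => //= n IHn.
  rewrite path_sortedE; last by move=> a b c; exact: leq_trans.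
  by rewrite IHn andbT all_cat ri andbT all_nseq /leI leqnn orbT.
- exact: ss.
- apply/allP => i _ /=; rewrite count_flatten -map_comp.
  rewrite (eq_map (g := fun k => (count_mem k s * (k == i))%N)); last first.
    by move=> k /=; rewrite count_nseq mulnC.
  rewrite sumnE big_map big_enum /= (bigD1 i)//= eqxx muln1 big1 ?addn0//.
  by move=> k /negbTE ->; rewrite muln0.
Qed.

(** A sorted word is one of the multi-indices of the sum, and the other terms are nonnegative
    because [Ck] makes them true suprema. *)
Lemma pderiv_le_Ck_norm k f s x : Ck k f -> sorted leI s -> (size s <= k)%N ->
  `|pderiv s f x| <= Ck_norm k f.
Proof.
move=> [_ bf] ss sk.
(* [inord] does not truncate here: a count is at most [size s <= k]. *)
pose a : {ffun 'I_d -> 'I_k.+1} := [ffun i => inord (count_mem i s)].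
have aE i : a i = count_mem i s :> nat.
  by rewrite ffunE inordK// ltnS (leq_trans (count_size _ _)).
have sizeE (b : {ffun 'I_d -> 'I_k.+1}) :
    size (flatten [seq nseq (b i) i | i <- enum 'I_d]) = (\sum_(i < d) b i)%N.
  rewrite size_flatten /shape -map_comp sumnE big_map big_enum.
  by apply: eq_big => // i _ /=; rewrite size_nseq.
have afE : flatten [seq nseq (a i) i | i <- enum 'I_d] = s.
  rewrite -[RHS](sorted_flatten_count ss); congr flatten.
  by apply: eq_map => i; rewrite aE.
have ubd (b : {ffun 'I_d -> 'I_k.+1}) y : (\sum_(i < d) b i <= k)%N ->
    `|mderiv b f y| <= sup (range (fun x => `|mderiv b f x|)).
  move=> bk; apply: ub_le_sup; last by exists y.
  have [|M hM] := bf (flatten [seq nseq (b i) i | i <- enum 'I_d]); first by rewrite sizeE.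
  by exists M => _ [z _ <-]; exact: hM.
have ak : (\sum_(i < d) a i <= k)%N by rewrite -sizeE afE.
rewrite /Ck_norm (bigD1 a)//= -[leLHS]addr0 lerD//.
  by have := ubd a x ak; rewrite /mderiv afE.
by apply: sumr_ge0 => b /andP[bk _]; exact: le_trans (normr_ge0 _) (ubd b 0 bk).
Qed.

Lemma Ck_norm_ge0 k f : Ck k f -> 0 <= Ck_norm k f.
Proof.
move=> hf; apply: le_trans (normr_ge0 (pderiv [::] f 0)) _.
exact: pderiv_le_Ck_norm.
Qed.

Lemma coord_le_enorm (h : 'rV[R]_d) i : `|h 0 i| <= enorm h.
Proof.
rewrite /enorm -sqrtr_sqr ler_sqrt; last by rewrite sumr_ge0// => j _; rewrite sqr_ge0.
by rewrite (bigD1 i)//= lerDl sumr_ge0// => j _; rewrite sqr_ge0.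
Qed.

Lemma enorm_ge0 (h : 'rV[R]_d) : 0 <= enorm h.
Proof. exact: sqrtr_ge0. Qed.

(** The first summand is the constant of the second-order remainder. The other two bound the
    first-order remainder and the quadratic term, for large increments. Their sum covers both
    regimes. *)
Definition taylor_const : R :=
  d%:R * (1 + d%:R * (1 + d%:R) + d%:R) + d%:R * (1 + d%:R) + d%:R * d%:R.

Lemma min_sqr_cube_le_powR (eta g : R) : 0 <= eta -> 0 < g -> g <= 1 ->
  eta ^+ 3 <= eta `^ (2 + g) \/ eta ^+ 2 <= eta `^ (2 + g).
Proof.
move=> eta0 g0 g1; have [le1|gt1] := leP eta 1; last first.
  by right; rewrite -powR_mulrn// ler_powR ?ltW//; lra.
left; move: eta0; rewrite le_eqVlt => /predU1P[<-|eta0].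
  by rewrite expr0n powR_ge0.
rewrite -powR_mulrn ?(ltW eta0)// ger_powR ?eta0//=.
by lra.
Qed.

(* Only derivatives in increasing order of the indices occur, as these are the
   ones that Ck_norm controls: the coordinates are moved in increasing order,
   and each new derivative is taken at a smaller index. *)
Lemma taylor_Ck f x : Ck 4 f ->
  exists (b : 'I_d -> R) (c : 'I_d -> 'I_d -> R),
  forall (h : 'rV[R]_d) (g : R), 0 < g -> g <= 1 ->
  `|f (x + h) - f x - \sum_(i < d) b i * h 0 i
     - \sum_(i < d) \sum_(j < d) c i j * (h 0 i * h 0 j)|
  <= taylor_const * Ck_norm 4 f * enorm h `^ (2 + g).
Proof.
move=> hf; set K := Ck_norm 4 f; have K0 : 0 <= K by exact: Ck_norm_ge0.
have [dern _] := hf.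
(* The coefficients are chosen before [h] and [g], so that the same quadratic polynomial is averaged
   under both laws. *)
exists (fun i => pderiv [:: i] f x).
(* Triangular form of the Hessian: half of each pure derivative on the diagonal, each mixed
   derivative once, for [j < i]. *)
exists (fun i j => if j == i then pderiv [:: i; i] f x / 2
  else if (j < i)%N then pderiv [:: j; i] f x else 0) => h g g0 g1.
set S1 := \sum_(i < d) _ * h 0 i; set S2 := \sum_(i < d) _.
set eta := enorm h; have eta0 : 0 <= eta by exact: enorm_ge0.
have heta i : `|h 0 i| <= eta by exact: coord_le_enorm.
have D1 i y : derivable f y (e i) by exact: (dern [::]).
have D2 i j y : derivable (pderiv [:: i] f) y (e j) by exact: (dern [:: i]).
have D3 i j k y : derivable (pderiv [:: j; i] f) y (e k) by exact: (dern [:: j; i]).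
have B2 (i j : 'I_d) y : (j <= i)%N -> `|pderiv [:: j; i] f y| <= K.
  by move=> ji; apply: pderiv_le_Ck_norm => //=; rewrite /leI ji.
have B3 (i j k : 'I_d) y : (k <= j)%N -> (j <= i)%N -> `|pderiv [:: k; j; i] f y| <= K.
  by move=> kj ji; apply: pderiv_le_Ck_norm => //=; rewrite /leI kj ji.
have T1 : `|f (x + h) - f x - S1| <= d%:R * ((1 + d%:R) * (K * eta ^+ 2)).
  have := @taylor1_head _ _ f x h K eta d (leqnn d) K0 eta0 heta.
  rewrite head_part_full => H.
  rewrite (_ : S1 = \sum_(i < d | (i < d)%N) h 0 i * 'D_(e i) f x); last first.
    by apply: eq_big => [i|i _]; [rewrite ltn_ord|rewrite mulrC].
  apply: H => [i _ y|i j _ y|i j /andP[ji _] y].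
  - exact: D1.
  - exact: D2.
  - exact: (B2 i j y ji).
have T2 : `|f (x + h) - f x - S1 - S2| <=
    d%:R * ((1 + d%:R * (1 + d%:R) + d%:R) * (K * eta ^+ 3)).
  have := @taylor2_head _ _ f x h K eta d (leqnn d) K0 eta0 heta.
  rewrite head_part_full => H.
  rewrite -addrA -opprD (_ : S1 + S2 = \sum_(i < d | (i < d)%N)
      (h 0 i * 'D_(e i) f x + h 0 i ^+ 2 / 2 * 'D_(e i) (fun x => 'D_(e i) f x) x +
       h 0 i * \sum_(j < d | (j < i)%N)
         h 0 j * 'D_(e j) (fun x => 'D_(e i) f x) x)); last first.
    rewrite -big_split; apply: eq_big => [i|i _]; first by rewrite ltn_ord.
    rewrite /= -addrA [_ * h 0 i]mulrC; congr (_ + _).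
    rewrite (bigD1 i)//= eqxx; congr (_ + _).
      by rewrite -expr2; field.
    rewrite big_distrr /= big_mkcond [RHS]big_mkcond; apply: eq_bigr => j _.
    have [->|ji] := eqVneq j i; first by rewrite ltnn.
    by case: ifP => _ /=; [ring|rewrite mul0r].
  apply: H => [i _ y|i j _ y|i j k _ _ y|i j k kj /andP[ji _] y].
  - exact: D1.
  - exact: D2.
  - exact: D3.
  - exact: (B3 i j k y kj ji).
(* For large [h] the cubic bound is too weak; the quadratic term is then estimated outright and
   joined to the first-order remainder. *)
have T3 : `|S2| <= d%:R * d%:R * (K * eta ^+ 2).
  rewrite (le_trans (ler_norm_sum _ _ _))//.
  have -> : d%:R * d%:R * (K * eta ^+ 2) = \sum_(i < d) d%:R * (K * eta ^+ 2).
    by rewrite sumr_const card_ord -mulrA mulr_natl.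
  apply: ler_sum => i _; rewrite (le_trans (ler_norm_sum _ _ _))//.
  have -> : d%:R * (K * eta ^+ 2) = \sum_(j < d) K * eta ^+ 2.
    by rewrite sumr_const card_ord mulr_natl.
  apply: ler_sum => j _; rewrite normrM; apply: ler_pM => //; last first.
    by rewrite normrM expr2 ler_pM.
  case: eqP => _.
    have := B2 i i x (leqnn i); rewrite normrM [`|2^-1|]ger0_norm ?invr_ge0//.
    by have := normr_ge0 (pderiv [:: i; i] f x); lra.
  by case: ifPn => [ji|_]; [apply: B2; exact: ltnW|rewrite normr0].
have d0 : (0 : R) <= d%:R by [].
have Keta n : 0 <= K * eta ^+ n by rewrite mulr_ge0 ?exprn_ge0.
have dd0 : (0 : R) <= d%:R * d%:R by exact: mulr_ge0.
have d3 : (0 : R) <= d%:R * (1 + d%:R * (1 + d%:R) + d%:R).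
  by rewrite mulr_ge0// !addr_ge0// mulr_ge0// addr_ge0.
have d2 : (0 : R) <= d%:R * (1 + d%:R) by rewrite mulr_ge0// addr_ge0.
have le_powR n : eta ^+ n <= eta `^ (2 + g) ->
    `|f (x + h) - f x - S1 - S2| <= taylor_const * (K * eta ^+ n) ->
    `|f (x + h) - f x - S1 - S2| <= taylor_const * K * eta `^ (2 + g).
  move=> hn H; rewrite (le_trans H)// mulrA ler_wpM2l// mulr_ge0//.
  by rewrite /taylor_const !addr_ge0.
have [h3|h2] := min_sqr_cube_le_powR eta0 g0 g1.
- apply: (le_powR 3%N h3); rewrite (le_trans T2)// mulrA ler_wpM2r//.
  rewrite /taylor_const; move: d3 d2 dd0.
  by set u := _ * (1 + _ + _); set v := d%:R * (1 + _); set w := d%:R * _; lra.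
- apply: (le_powR 2%N h2); rewrite (le_trans (ler_normB _ _))//.
  rewrite (le_trans (lerD T1 T3))// mulrA -mulrDl ler_wpM2r//.
  rewrite /taylor_const; move: d3 d2 dd0.
  by set u := _ * (1 + _ + _); set v := d%:R * (1 + _); set w := d%:R * _; lra.
Qed.

End Ck_taylor.

(** * Means and the Lindeberg exchange *)

(** Integrability is bundled with a real value, so that means are computed in [R] rather than in the
    extended reals. *)
Definition has_mean (R : realType) (dT : measure_display) (T : measurableType dT)
    (P : probability T R) (F : T -> R) (v : R) : Prop :=
  P.-integrable [set: T] (EFin \o F) /\ (\int[P]_w (F w)%:E = v%:E)%E.

Section has_mean.
Context (R : realType) (dT : measure_display) (T : measurableType dT)
  (P : probability T R).
Implicit Types (F G : T -> R) (u v : R).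

Lemma has_mean_cst v : has_mean P (cst v) v.
Proof.
split; last first.
  transitivity (\int[P]_w cst v%:E w)%E => //.
  by rewrite integral_cst//= probability_setT mule1.
exact: finite_measure_integrable_cst.
Qed.

Lemma has_meanD F G u v : has_mean P F u -> has_mean P G v ->
  has_mean P (fun w => F w + G w) (u + v).
Proof.
move=> [iF eF] [iG eG]; split.
  exact: (integrableD measurableT iF iG).
rewrite -[RHS]/(u%:E + v%:E)%E -eF -eG -integralD//.
Qed.

Lemma has_meanZ k F u : has_mean P F u -> has_mean P (fun w => k * F w) (k * u).
Proof.
move=> [iF eF]; split.
  exact: (integrableZl measurableT k iF).
by rewrite EFinM -eF -integralZl.
Qed.

Lemma has_meanB F G u v : has_mean P F u -> has_mean P G v ->
  has_mean P (fun w => F w - G w) (u - v).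
Proof.
move=> hF /(has_meanZ (-1)); rewrite mulN1r => hG.
by have := has_meanD hF hG; under eq_fun do rewrite mulN1r.
Qed.

Lemma has_mean_sum (J : Type) (s : seq J) (F : J -> T -> R) (v : J -> R) :
  (forall j, has_mean P (F j) (v j)) ->
  has_mean P (fun w => \sum_(j <- s) F j w) (\sum_(j <- s) v j).
Proof.
move=> hF; elim: s => [|j s IH].
  rewrite big_nil; under eq_fun do rewrite big_nil.
  exact: has_mean_cst.
rewrite big_cons; under eq_fun do rewrite big_cons.
exact: has_meanD.
Qed.

Lemma has_mean_dominated F G u : measurable_fun [set: T] F -> has_mean P G u ->
  (forall w, `|F w| <= G w) -> exists v, has_mean P F v.
Proof.
move=> mF [iG eG] FG.
have iF : P.-integrable setT (EFin \o F).
  apply: le_integrable iG => //; first exact/measurable_EFinP.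
  move=> w _ /=; rewrite lee_fin (le_trans (FG w))//.
  by rewrite ler_norm.
exists (fine (\int[P]_w (F w)%:E)).
by split => //; rewrite fineK//; exact: integrable_fin_num.
Qed.

Lemma has_mean_bounded F u v B : has_mean P F v -> has_mean P B u ->
  (forall w, `|F w| <= B w) -> `|v| <= u.
Proof.
move=> [iF eF] [iB eB] FB.
rewrite -lee_fin -eB -[`|v|%:E]/(`|v%:E|)%E -eF.
apply: (le_trans (le_abse_integral _ _ _)) => //; first exact: measurable_int iF.
apply: ge0_le_integral => //.
- by apply: measurableT_comp => //; exact: measurable_int iF.
- exact: measurable_int iB.
- by move=> w _ /=; rewrite lee_fin.
Qed.


Lemma has_mean_ge0_fin F : measurable_fun [set: T] F -> (forall w, 0 <= F w) ->
  (\int[P]_w (F w)%:E < +oo)%E ->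
  has_mean P F (fine (\int[P]_w (F w)%:E)).
Proof.
move=> mF F0 Foo.
have iF : P.-integrable setT (EFin \o F).
  apply/integrableP; split; first exact/measurable_EFinP.
  by under eq_integral do rewrite /= ger0_norm//.
by split => //; rewrite fineK//; exact: integrable_fin_num.
Qed.

Lemma has_mean_ge0 F v : has_mean P F v -> (forall w, 0 <= F w) -> 0 <= v.
Proof.
move=> [_ eF] F0; rewrite -lee_fin -eF.
by apply: integral_ge0 => w _; rewrite lee_fin.
Qed.

End has_mean.

(** Bounded first partial derivatives make [f] Lipschitz for the sup norm, along the staircase path.
    Continuity is what makes [f] Borel. *)
Lemma Ck_continuous (R : realType) (d : nat) (f : 'rV[R]_d -> R) :
  Ck 4 f -> continuous f.
Proof.
move=> hf x; have K0 := Ck_norm_ge0 hf; have [dern _] := hf.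
have lip h : `|f (x + h) - f x| <= d%:R * (Ck_norm 4 f * `|h|).
  have h0 : 0 <= `|h| by [].
  have hh i : `|h 0 i| <= `|h|.
    rewrite -[leRHS]/(mx_norm h) mx_normrE.
    exact: (le_bigmax _ (fun ij : 'I_1 * 'I_d => `|h ij.1 ij.2|) (0, i)).
  have := @taylor0_head _ _ f x h _ `|h| d (leqnn d) K0 h0 hh.
  rewrite head_part_full; apply => i _ y; first exact: (dern [::]).
  exact: (pderiv_le_Ck_norm (s := [:: i]) y hf).
apply/(cvgrPdist_le (FF := nbhs_filter x)) => e e0.
have dK : 0 < d%:R * Ck_norm 4 f + 1 by rewrite ltr_wpDl// mulr_ge0.
have r0 : 0 < (d%:R * Ck_norm 4 f + 1)^-1 * e by rewrite mulr_gt0 ?invr_gt0.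
apply: (filterS _ (nbhsx_ballx x _ r0)) => y; rewrite -ball_normE /= => xy.
rewrite distrC -(subrKC x y) (le_trans (lip _))//.
rewrite (@le_trans _ _ ((d%:R * Ck_norm 4 f + 1) * `|y - x|))//.
  by rewrite mulrA ler_wpM2r// lerDl.
by rewrite -ler_pdivlMl// ltW// distrC.
Qed.

Lemma enormZ (R : realType) (d : nat) (c : R) (y : 'rV[R]_d) :
  enorm (c *: y) = `|c| * enorm y.
Proof.
rewrite /enorm -sqrtr_sqr -sqrtrM ?sqr_ge0// mulr_sumr; congr Num.sqrt.
by apply: eq_bigr => i _; rewrite mxE exprMn.
Qed.

Lemma measurable_enorm (R : realType) (d : nat) :
  measurable_fun [set: borel_rV R d] (fun y : borel_rV R d => enorm (rv_val y)).
Proof.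
apply: (measurableT_comp (continuous_measurable_fun (@sqrt_continuous R))).
apply: measurable_sum => i; apply: measurable_funX.
exact: measurable_coord.
Qed.

(** All that the one-step comparison uses of a law, in a form shared by the summands and the
    Gaussian vector. *)
Definition has_moments (R : realType) (d : nat) (dT : measure_display)
    (T : measurableType dT) (P : probability T R) (Y : T -> borel_rV R d)
    (S : 'M[R]_d) (r M : R) : Prop :=
  [/\ measurable_fun [set: T] Y,
      forall i, has_mean P (fun w => rv_val (Y w) 0 i) 0,
      forall i j, has_mean P (fun w => rv_val (Y w) 0 i * rv_val (Y w) 0 j) (S i j)
    & has_mean P (fun w => enorm (rv_val (Y w)) `^ r) M].

(** * Comparison of one averaging step, and its iteration *)

Section one_step.
Context (R : realType) (d : nat) (S : 'M[R]_d) (f : 'rV[R]_d -> R).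
Hypothesis Cf : Ck 4 f.

Lemma Ck_bounded : exists2 B, 0 <= B & forall x, `|f x| <= B.
Proof.
have [_ /(_ [::] isT)[B hB]] := Cf; exists B => //.
exact: le_trans (normr_ge0 _) (hB 0).
Qed.

Lemma has_mean_Ck (dT : measure_display) (T : measurableType dT)
    (P : probability T R) (Y : T -> borel_rV R d) :
  measurable_fun [set: T] Y -> exists v, has_mean P (fun w => f (Y w)) v.
Proof.
move=> mY; have [B B0 hB] := Ck_bounded.
apply: (@has_mean_dominated _ _ _ _ _ (cst B) B) => //; last exact: has_mean_cst.
exact: (measurableT_comp (continuous_measurable_rV (Ck_continuous Cf)) mY).
Qed.

(** The linear part has mean zero and the mean of the quadratic part is a function of [S], so [v] is
    compared with a quantity that is the same for every law with these moments. *)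
Lemma taylor_mean (dT : measure_display) (T : measurableType dT)
    (P : probability T R) (Y : T -> borel_rV R d) (g M h K v : R) x b c :
  has_moments P Y S (2 + g) M -> 0 <= h ->
  (forall y : 'rV[R]_d, `|f (x + y) - f x - \sum_(i < d) b i * y 0 i
     - \sum_(i < d) \sum_(j < d) c i j * (y 0 i * y 0 j)| <= K * enorm y `^ (2 + g)) ->
  has_mean P (fun w => f (x + h *: rv_val (Y w))) v ->
  `|v - f x - \sum_(i < d) \sum_(j < d) c i j * (h ^+ 2 * S i j)|
    <= K * (h `^ (2 + g) * M).
Proof.
move=> [mY mean cov mom] h0 hT hv.
have hb : has_mean P (fun w => \sum_(i < d) b i * (h *: rv_val (Y w)) 0 i) 0.
  rewrite [X in has_mean _ _ X](_ : 0 = \sum_(i < d) b i * (h * 0)); last first.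
    by rewrite big1// => i _; rewrite !mulr0.
  apply: has_mean_sum => i; apply: has_meanZ.
  under eq_fun do rewrite mxE.
  exact: has_meanZ.
have hc : has_mean P (fun w => \sum_(i < d) \sum_(j < d)
      c i j * ((h *: rv_val (Y w)) 0 i * (h *: rv_val (Y w)) 0 j))
    (\sum_(i < d) \sum_(j < d) c i j * (h ^+ 2 * S i j)).
  apply: has_mean_sum => i; apply: has_mean_sum => j; apply: has_meanZ.
  under eq_fun do rewrite !mxE mulrACA -expr2.
  exact: has_meanZ.
have := has_meanB (has_meanB (has_meanB hv (has_mean_cst P (f x))) hb) hc.
rewrite subr0 => hF; apply: (has_mean_bounded hF (has_meanZ K (has_meanZ (h `^ (2 + g)) mom))).
move=> w; rewrite (le_trans (hT _))// enormZ ger0_norm// powRM ?sqrtr_ge0//.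
Qed.

Lemma lindeberg_step (dT dU : measure_display) (T : measurableType dT)
    (U : measurableType dU) (P : probability T R) (Q : probability U R)
    (Y : T -> borel_rV R d) (W : U -> borel_rV R d) (g M M' h u v : R) x :
  0 < g -> g <= 1 -> 0 <= h ->
  has_moments P Y S (2 + g) M -> has_moments Q W S (2 + g) M' ->
  has_mean P (fun w => f (x + h *: rv_val (Y w))) u ->
  has_mean Q (fun w => f (x + h *: rv_val (W w))) v ->
  `|u - v| <= taylor_const R d * Ck_norm 4 f * (h `^ (2 + g) * (M + M')).
Proof.
move=> g0 g1 h0 hY hW hu hv.
have [b [c hT]] := taylor_Ck x Cf.
have := taylor_mean hY h0 (fun y => hT y g g0 g1) hu.
have := taylor_mean hW h0 (fun y => hT y g g0 g1) hv.
set q := \sum_(i < d) _; move=> Hv Hu.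
have -> : u - v = (u - f x - q) - (v - f x - q) by ring.
by rewrite (le_trans (ler_normB _ _))// mulrDr mulrDr lerD.
Qed.

(** The shift by [B] provides the nonnegativity that the operators require. [iter_avg_le] is
    one-sided, hence applied with the two laws in both orders. *)
Lemma lindeberg (dT dU : measure_display) (T : measurableType dT)
    (U : measurableType dU) (P : probability T R) (Q : probability U R)
    (Y : T -> borel_rV R d) (W : U -> borel_rV R d) (g M M' h B u v : R) n :
  0 < g -> g <= 1 -> 0 <= h ->
  has_moments P Y S (2 + g) M -> has_moments Q W S (2 + g) M' ->
  (forall x, `|f x| <= B) ->
  let G := fun y : borel_rV R d => (f y + B)%:E in
  iter n (avg P (fun w => h *: Y w)) G 0 = (u + B)%:E ->
  iter n (avg Q (fun w => h *: W w)) G 0 = (v + B)%:E ->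
  `|u - v| <= n%:R * (taylor_const R d * Ck_norm 4 f * (h `^ (2 + g) * (M + M'))).
Proof.
move=> g0 g1 h0 hY hW hB G hu hv.
set e := taylor_const R d * _ * _.
have [mY _ _ hM] := hY; have [mW _ _ hM'] := hW.
have mhY : measurable_fun setT (fun w => h *: Y w : borel_rV R d).
  exact: (measurable_funZ_rV (measurable_cst _) mY).
have mhW : measurable_fun setT (fun w => h *: W w : borel_rV R d).
  exact: (measurable_funZ_rV (measurable_cst _) mW).
have nmG : nonneg_measurable G.
  split.
    apply/measurable_EFinP; apply: measurable_funD => //.
    exact: (continuous_measurable_rV (Ck_continuous Cf)).
  move=> x; rewrite lee_fin; have := hB x.
  by rewrite ler_norml => /andP[+ _]; lra.
have avgE dV (V : measurableType dV) (m : probability V R) (Z : V -> borel_rV R d) x t :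
    has_mean m (fun w => f (x + Z w)) t -> avg m Z G x = (t + B)%:E.
  by move=> ht; have [_ <-] := has_meanD ht (has_mean_cst m B).
have step x : exists u' v', [/\ avg P (fun w => h *: Y w) G x = (u' + B)%:E,
    avg Q (fun w => h *: W w) G x = (v' + B)%:E & `|u' - v'| <= e].
  have [u' hu'] := has_mean_Ck P (measurable_funD_rV (measurable_cst (x : borel_rV R d)) mhY).
  have [v' hv'] := has_mean_Ck Q (measurable_funD_rV (measurable_cst (x : borel_rV R d)) mhW).
  exists u', v'; split; [exact: avgE|exact: avgE|].
  exact: lindeberg_step hu' hv'.
have e0 : 0 <= e by have [u' [v' [_ _]]] := step 0; exact: le_trans.
have H1 : (iter n (avg P (fun w => (h *: Y w)%R)) G 0%R <=
    iter n (avg Q (fun w => (h *: W w)%R)) G 0%R + (n%:R * e)%:E)%E.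
  apply: iter_avg_le => // y; have [u' [v' [-> -> ]]] := step y.
  by rewrite -EFinD lee_fin ler_norml => /andP[_]; lra.
have H2 : (iter n (avg Q (fun w => (h *: W w)%R)) G 0%R <=
    iter n (avg P (fun w => (h *: Y w)%R)) G 0%R + (n%:R * e)%:E)%E.
  apply: iter_avg_le => // y; have [u' [v' [-> -> ]]] := step y.
  by rewrite -EFinD lee_fin ler_norml => /andP[+ _]; lra.
move: H1 H2; rewrite hu hv -!EFinD !lee_fin ler_norml => H1 H2.
by apply/andP; split; lra.
Qed.

End one_step.

(** * Moments *)

Section moments.
Context (R : realType) (d : nat) (dT : measure_display) (T : measurableType dT)
  (P : probability T R) (Y : T -> borel_rV R d).
Hypothesis mY : measurable_fun [set: T] Y.

Lemma measurable_coord_comp i : measurable_fun [set: T] (fun w => rv_val (Y w) 0 i).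
Proof. exact: (measurableT_comp (measurable_coord i) mY). Qed.

Lemma measurable_enorm_powR (r : R) :
  measurable_fun [set: T] (fun w => enorm (rv_val (Y w)) `^ r).
Proof.
apply: (measurableT_comp (measurable_powR r)).
exact: (measurableT_comp (measurable_enorm (R := R) (d := d)) mY).
Qed.

Lemma square_has_mean i (s : R) :
  (\int[P]_w (rv_val (Y w) 0 i ^+ 2)%:E = s%:E)%E ->
  has_mean P (fun w => rv_val (Y w) 0 i ^+ 2) s.
Proof.
move=> h; have := @has_mean_ge0_fin _ _ _ P (fun w => rv_val (Y w) 0 i ^+ 2).
rewrite h /=; apply => //; last exact: ltry.
  by apply: measurable_funX; exact: measurable_coord_comp.
by move=> w; exact: sqr_ge0.
Qed.

Lemma coord_mean_exists i (s : R) :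
  (\int[P]_w (rv_val (Y w) 0 i ^+ 2)%:E = s%:E)%E ->
  exists v, has_mean P (fun w => rv_val (Y w) 0 i) v.
Proof.
move=> /square_has_mean/(has_meanD (has_mean_cst P 1)) h.
apply: (has_mean_dominated _ h) => [|w]; first exact: measurable_coord_comp.
rewrite -real_normK ?num_real//=.
by set a := `| _ |; have := sqr_ge0 (a - 1); nra.
Qed.

Lemma coord_prod_mean_exists i j (s t : R) :
  (\int[P]_w (rv_val (Y w) 0 i ^+ 2)%:E = s%:E)%E ->
  (\int[P]_w (rv_val (Y w) 0 j ^+ 2)%:E = t%:E)%E ->
  exists v, has_mean P (fun w => rv_val (Y w) 0 i * rv_val (Y w) 0 j) v.
Proof.
move=> /square_has_mean hi /square_has_mean hj.
apply: (has_mean_dominated _ (has_meanD hi hj)) => [|w].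
  by apply: measurable_funM; exact: measurable_coord_comp.
have nK (z : R) : z ^+ 2 = `|z| ^+ 2 by rewrite real_normK ?num_real.
rewrite normrM (nK (rv_val (Y w) 0 i)) (nK (rv_val (Y w) 0 j));
set a := `|_ (Y w) 0 i|; set b := `|_ (Y w) 0 j|.
have ab : 0 <= a * b by apply: mulr_ge0; exact: normr_ge0.
by have := sqr_ge0 (a - b); nra.
Qed.

Lemma enorm_sqr (y : 'rV[R]_d) : enorm y ^+ 2 = \sum_(i < d) y 0 i ^+ 2.
Proof. by rewrite /enorm sqr_sqrtr// sumr_ge0// => i _; rewrite sqr_ge0. Qed.

End moments.

(* A lower bound on the (2+g)-th moment uniform in g: on |y| < s the square is
   below t/2, and elsewhere |y|^g >= s^g >= s. *)
Lemma moment_lower_bound (R : realType) (d : nat) (S : 'M[R]_d)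
    (dT : measure_display) (T : measurableType dT) (P : probability T R)
    (Y : T -> borel_rV R d) (g M : R) :
  0 < g -> g <= 1 -> 0 < \tr S -> has_moments P Y S (2 + g) M ->
  Num.min 1 (Num.sqrt (\tr S / 2)) * (\tr S / 2) <= M.
Proof.
move=> g0 g1; set t := \tr S => t0 [mY _ cov mom].
set s := Num.min 1 _.
have t2 : 0 < t / 2 by rewrite divr_gt0.
have s0 : 0 < s by rewrite lt_min ltr01 sqrtr_gt0.
have s1 : s <= 1 by rewrite ge_min lexx.
have sst : s ^+ 2 <= t / 2.
  rewrite -[leRHS](sqr_sqrtr (ltW t2)) lerXn2r ?nnegrE ?sqrtr_ge0 ?(ltW s0)//.
  by rewrite ge_min lexx orbT.
have hsq : has_mean P (fun w => enorm (rv_val (Y w)) ^+ 2) t.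
  rewrite /t /mxtrace; under eq_fun do rewrite enorm_sqr.
  by apply: has_mean_sum => i; under eq_fun do rewrite expr2; exact: cov.
(* Integrating the pointwise bound |y|^(2+g) >= s (|y|^2 - t/2) gives M >= s (t - t/2), because
   E|Y|^2 = t. The minimum with 1 in [s] ensures s <= s^g. *)
have := has_meanB mom (has_meanZ s (has_meanB hsq (has_mean_cst P (t / 2)))).
move=> /has_mean_ge0 H.
have {H} : 0 <= M - s * (t - t / 2).
  apply: H => w; rewrite /cst; set a := enorm _.
  have a0 : 0 <= a by exact: enorm_ge0.
  rewrite subr_ge0; have [sa|sa] := leP s a; last first.
    have : a ^+ 2 <= s ^+ 2 by rewrite lerXn2r ?nnegrE ?(ltW s0) ?(ltW sa).
    have := powR_ge0 a (2 + g); nra.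
  have a_gt0 : 0 < a by exact: lt_le_trans sa.
  rewrite powRD; last by apply/implyP => _; rewrite gt_eqF.
  rewrite powR_mulrn//.
  have sag : s <= a `^ g.
    apply: (@le_trans _ _ (s `^ g)).
      by rewrite -[leLHS](powRr1 (ltW s0)) ger_powR// s0.
    by rewrite ge0_ler_powR ?nnegrE ?(ltW s0) ?(ltW g0).
  have : s * a ^+ 2 <= a ^+ 2 * a `^ g by rewrite mulrC ler_wpM2l// exprn_ge0.
  have : 0 <= s * (t / 2) by rewrite mulr_ge0 ?(ltW s0) ?(ltW t2).
  by lra.
have -> : t - t / 2 = t / 2 by field.
by rewrite subr_ge0.
Qed.

(** The hypotheses give values of integrals but not integrability, which is recovered from the
    diagonal: squares with finite integral dominate the coordinates and their products. *)
Lemma centered_has_moments (R : realType) (d : nat) (S : 'M[R]_d)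
    (dT : measure_display) (T : measurableType dT) (P : probability T R)
    (X : {RV P >-> borel_rV R d}) (r : R) :
  centered X -> has_covariance X S ->
  (\int[P]_w (enorm (rv_val (X w)) `^ r)%:E < +oo)%E ->
  has_moments P X S r (fine (\int[P]_w (enorm (rv_val (X w)) `^ r)%:E)%E).
Proof.
move=> cX covX hM.
have mX : measurable_fun [set: T] X by exact: measurable_funP.
have E0 i : (\int[P]_w (rv_val (X w) 0%R i)%:E = 0)%E.
  by have := cX i; rewrite unlock.
have E2 i j : (\int[P]_w (rv_val (X w) 0%R i * rv_val (X w) 0%R j)%:E = (S i j)%:E)%E.
  rewrite -covX unlock ![in RHS]unlock !E0 /=.
  apply: eq_integral => w _; congr (_%:E).
  by rewrite -[RHS]/((rv_val (X w) 0 i - 0) * (rv_val (X w) 0 j - 0)) !subr0.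
have Esq i : (\int[P]_w (rv_val (X w) 0%R i ^+ 2)%:E = (S i i)%:E)%E.
  by rewrite -E2; apply: eq_integral => w _; rewrite expr2.
split => // [i|i j|].
- have [v [iv _]] := coord_mean_exists mX (Esq i).
  by split => //; exact: E0.
- have [v [iv _]] := coord_prod_mean_exists mX (Esq i) (Esq j).
  by split => //; exact: E2.
- apply: has_mean_ge0_fin => //; first exact: measurable_enorm_powR.
  by move=> w; exact: powR_ge0.
Qed.

Definition normal_fourth_moment (R : realType) : R :=
  fine (\int[normal_prob (0 : R) 1]_z (z ^+ 4)%:E)%E.

(** * Moments of the Gaussian vector *)

Section gaussian_moments.
Context (R : realType) (d l : nat) (dU : measure_display) (U : measurableType dU)
  (Q : probability U R) (A : 'M[R]_(d, l)) (Z : 'I_l -> {RV Q >-> R}).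
Hypothesis indZ : mutually_independent Z.
Hypothesis lawZ : forall (j : 'I_l) (B : set R), measurable B ->
  distribution Q (Z j) B = normal_prob 0 1 B.
Local Notation W := (gaussian_comb A Z).
Local Notation S := (A *m A^T).
Local Notation N := (normal_prob (0 : R) 1).

Let mW : measurable_fun [set: U] W. Proof. exact: measurable_gaussian_comb. Qed.

Let SE i k : S i k = \sum_(j < l) A i j * A k j.
Proof. by rewrite mxE; apply: eq_bigr => j _; rewrite mxE. Qed.

Let W_coord i (phi : R -> \bar R) : nonneg_measurable phi ->
  (\int[Q]_w phi (rv_val (W w) 0%R i) = \int[N]_z phi (Num.sqrt (S i i) * z)%R)%E.
Proof.
move=> hphi.
have delta (F : 'I_d -> R) : \sum_(k < d) (k == i)%:R * F k = F i.
  rewrite (bigD1 i)//= eqxx mul1r big1 ?addr0// => k /negbTE ->.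
  by rewrite mul0r.
have := integral_gaussian_linear A indZ lawZ (fun k => (k == i)%:R) hphi.
under eq_integral do rewrite delta; move=> ->.
apply: eq_integral => z _; congr (phi (Num.sqrt _ * z)).
by rewrite SE; apply: eq_bigr => j _; rewrite delta expr2.
Qed.

Let S_ge0 i : 0 <= S i i.
Proof. by rewrite SE sumr_ge0// => j _; rewrite -expr2 sqr_ge0. Qed.

Let normal_sqr_scale (s : R) : 0 <= s ->
  (\int[N]_z ((Num.sqrt s * z) ^+ 2)%:E = s%:E)%E.
Proof.
move=> s0; under eq_integral do rewrite exprMn sqr_sqrtr// EFinM.
rewrite ge0_integralZl//.
- by rewrite normal_second_moment mule1.
- exact: (nonneg_measurable_exprn2 R 1).1.
- by move=> z _; exact: (nonneg_measurable_exprn2 R 1).2.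
Qed.

Let W_sqr i : (\int[Q]_w (rv_val (W w) 0%R i ^+ 2)%:E = (S i i)%:E)%E.
Proof.
rewrite (W_coord i (phi := fun z => (z ^+ 2)%:E)); last exact: (nonneg_measurable_exprn2 R 1).
exact: normal_sqr_scale.
Qed.

Let W_mean i : (\int[Q]_w (rv_val (W w) 0%R i)%:E = 0)%E.
Proof.
have mE : measurable_fun [set: R] (EFin : R -> \bar R) by apply/measurable_EFinP.
have nmp : nonneg_measurable ((EFin : R -> \bar R)^\+)%E.
  by split; [exact: measurable_funepos|move=> x; exact: funepos_ge0].
have nmn : nonneg_measurable ((EFin : R -> \bar R)^\-)%E.
  by split; [exact: measurable_funeneg|move=> x; exact: funeneg_ge0].
rewrite -(normal_mean (Num.sqrt (S i i))) integralE [RHS]integralE; congr (_ - _)%E.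
- transitivity (\int[Q]_w (EFin : R -> \bar R)^\+ (rv_val (W w) 0%R i))%E.
    by apply: eq_integral => w _; rewrite !funeposE.
  by rewrite W_coord//; apply: eq_integral => z _; rewrite !funeposE.
- transitivity (\int[Q]_w (EFin : R -> \bar R)^\- (rv_val (W w) 0%R i))%E.
    by apply: eq_integral => w _; rewrite !funenegE.
  by rewrite W_coord//; apply: eq_integral => z _; rewrite !funenegE.
Qed.

(* By polarization, from the second moments of W_i, W_k and W_i + W_k. *)
Let W_prod i k :
  has_mean Q (fun w => rv_val (W w) 0 i * rv_val (W w) 0 k) (S i k).
Proof.
have hi := square_has_mean mW (W_sqr i); have hk := square_has_mean mW (W_sqr k).
have [v hv] := coord_prod_mean_exists mW (W_sqr i) (W_sqr k).
suff -> : S i k = v by [].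
pose lin (y : borel_rV R d) := rv_val y 0 i + rv_val y 0 k.
have h2 := has_meanD (has_meanD hi hk) (has_meanZ 2 hv).
have sumE (F : 'I_d -> R) : \sum_(a < d) ((a == i)%:R + (a == k)%:R) * F a = F i + F k.
  have delta b : \sum_(a < d) (a == b)%:R * F a = F b.
    rewrite (bigD1 b)//= eqxx mul1r big1 ?addr0// => a /negbTE ->.
    by rewrite mul0r.
  by under eq_bigr do rewrite mulrDl; rewrite big_split /= !delta.
have : (\int[Q]_w ((rv_val (W w) 0%R i + rv_val (W w) 0%R k) ^+ 2)%:E =
        (S i i + S k k + 2 * S i k)%:E)%E.
  have := integral_gaussian_linear A indZ lawZ (fun a => (a == i)%:R + (a == k)%:R)
    (phi := fun z => (z ^+ 2)%:E) (nonneg_measurable_exprn2 R 1).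
  under eq_integral do rewrite sumE; move=> ->.
  rewrite (eq_bigr (fun j => (A i j + A k j) ^+ 2)); last by move=> j _; rewrite sumE.
  rewrite normal_sqr_scale; last by rewrite sumr_ge0// => j _; rewrite sqr_ge0.
  rewrite !SE mulr_sumr -!big_split /=; congr (_%:E).
  by apply: eq_bigr => j _; ring.
have [_] := h2.
under eq_integral => w _.
  rewrite (_ : _ + _ = (rv_val (W w) 0 i + rv_val (W w) 0 k) ^+ 2); last by ring.
  over.
by move=> -> [] => h; lra.
Qed.

Local Notation m4 := (normal_fourth_moment R).

Let W_fourth i : has_mean Q (fun w => rv_val (W w) 0 i ^+ 4) (S i i ^+ 2 * m4).
Proof.
have nm4 := nonneg_measurable_exprn2 R 2.
have E4 : (\int[Q]_w (rv_val (W w) 0%R i ^+ 4)%:E = (S i i ^+ 2 * m4)%:E)%E.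
  rewrite (W_coord i (phi := fun z => (z ^+ 4)%:E)) //.
  under eq_integral do rewrite exprMn (exprM _ 2 2) sqr_sqrtr// EFinM.
  rewrite ge0_integralZl//.
  - rewrite /normal_fourth_moment [RHS]EFinM fineK// ge0_fin_numE.
      exact: normal_fourth_moment_lty.
    by apply: integral_ge0 => z _; exact: nm4.2.
  - exact: nm4.1.
  - by move=> z _; exact: nm4.2.
  - by rewrite lee_fin sqr_ge0.
have := @has_mean_ge0_fin _ _ _ Q (fun w => rv_val (W w) 0 i ^+ 4).
rewrite E4 /=; apply => //; last exact: ltry.
  by apply: measurable_funX; exact: measurable_coord_comp.
by move=> w; rewrite (exprM _ 2 2) sqr_ge0.
Qed.

(** From |y|^(2+g) <= 1 + |y|^4 and 2 a b <= a^2 + b^2 applied to squared coordinates, the bound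
    depends on the diagonal of [S] but not on [g]. Of the normal fourth moment only finiteness
    matters. *)
Lemma gaussian_comb_moments (g : R) : 0 < g -> g <= 1 ->
  exists2 M, has_moments Q W S (2 + g) M &
    M <= 1 + \sum_(i < d) \sum_(k < d) (S i i ^+ 2 * m4 + S k k ^+ 2 * m4).
Proof.
move=> g0 g1.
have h4 := has_meanD (has_mean_cst Q 1) (has_mean_sum (index_enum 'I_d)
  (fun i => has_mean_sum (index_enum 'I_d) (fun k => has_meanD (W_fourth i) (W_fourth k)))).
have bd w : `|enorm (rv_val (W w)) `^ (2 + g)| <=
    1 + \sum_(i < d) \sum_(k < d) (rv_val (W w) 0 i ^+ 4 + rv_val (W w) 0 k ^+ 4).
  rewrite ger0_norm ?powR_ge0//; set y := rv_val (W w).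
  have y4 : enorm y ^+ 4 <= \sum_(i < d) \sum_(k < d) (y 0 i ^+ 4 + y 0 k ^+ 4).
    rewrite (exprM _ 2 2) enorm_sqr expr2 mulr_suml; apply: ler_sum => i _.
    rewrite mulr_sumr; apply: ler_sum => k _.
    rewrite (exprM _ 2 2) (exprM (y 0 k) 2 2).
    set a := y 0 i ^+ 2; set b := y 0 k ^+ 2.
    by have := sqr_ge0 (a - b); have := sqr_ge0 (a + b); nra.
  have ye := enorm_ge0 y.
  have [le1|gt1] := leP (enorm y) 1.
    have : enorm y `^ (2 + g) <= 1.
      apply: (@le_trans _ _ (1 `^ (2 + g))); last by rewrite powR1.
      by rewrite ge0_ler_powR ?nnegrE// addr_ge0// ltW.
    have : 0 <= enorm y ^+ 4 by rewrite exprn_ge0.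
    by lra.
  have : enorm y `^ (2 + g) <= enorm y ^+ 4.
    by rewrite -powR_mulrn// ler_powR ?(ltW gt1)//; lra.
  by lra.
have [M hM] := has_mean_dominated (measurable_enorm_powR mW (2 + g)) h4 bd.
exists M; last exact: le_trans (ler_norm _) (has_mean_bounded hM h4 bd).
split => // i.
have [v [iv _]] := coord_mean_exists mW (W_sqr i).
by split => //; exact: W_mean.
Qed.

End gaussian_moments.

(** * The convergence rate *)

(** The trace is the sum of the squared entries of [A]; were it zero, [A *m A^T] would be a zero
    matrix of positive size, which is singular. *)
Lemma unitmx_tr_mul_gt0 (R : realType) (d l : nat) (A : 'M[R]_(d, l)) :
  (1 <= d)%N -> A *m A^T \in unitmx -> 0 < \tr (A *m A^T).
Proof.
move=> d1 SU.
have trE : \tr (A *m A^T) = \sum_(i < d) \sum_(j < l) A i j ^+ 2.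
  rewrite /mxtrace; apply: eq_bigr => i _; rewrite mxE; apply: eq_bigr => j _.
  by rewrite mxE expr2.
have row_ge0 i : 0 <= \sum_(j < l) A i j ^+ 2 by rewrite sumr_ge0// => j _; rewrite sqr_ge0.
rewrite lt_neqAle trE sumr_ge0// andbT eq_sym; apply/negP => /eqP tr0.
have A0 : A = 0.
  apply/matrixP => i j; rewrite mxE; apply/eqP; rewrite -sqrf_eq0.
  have ri : \sum_(j < l) A i j ^+ 2 = 0 := psumr_eq0P (fun i _ => row_ge0 i) tr0 isT.
  by apply/eqP; apply: (psumr_eq0P _ ri) => // k _; rewrite sqr_ge0.
case: d d1 A SU {trE row_ge0 tr0} A0 => // d _ A + A0.
by rewrite A0 mul0mx unitmxE det0 unitr0.
Qed.

Lemma identically_distributed_avg (R : realType) (d : nat) (dT : measure_display)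
    (T : measurableType dT) (P : probability T R) (X : nat -> {RV P >-> borel_rV R d})
    (h : R) (i j : nat) (g : borel_rV R d -> \bar R) :
  identically_distributed X -> nonneg_measurable g ->
  avg P (fun w => h *: X i w) g = avg P (fun w => h *: X j w) g.
Proof.
move=> idX hg; apply/funext => x.
have mg : measurable_fun setT (fun y : borel_rV R d => g (x + h *: y)).
  apply: measurable_shift => //.
  exact: (measurable_funZ_rV (measurable_cst _) (@measurable_id _ (borel_rV R d) setT)).
have E k : avg P (fun w => h *: X k w) g x =
    (\int[distribution P (X k)]_y g (x + h *: y)%R)%E.
  by rewrite ge0_integral_distribution// => y; exact: hg.2.
rewrite !E; apply: eq_measure_integral => B mB _; exact: idX.
Qed.

(** The rate: [n] exchanges, each of order h^(2+g) with h = n^(-1/2). *)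
Lemma sqrt_inv_powR (R : realType) (n : nat) (g : R) : (0 < n)%N ->
  n%:R * (Num.sqrt n%:R)^-1 `^ (2 + g) = (n%:R `^ (g / 2))^-1 :> R.
Proof.
move=> n0; have nR : (0 : R) < n%:R by rewrite ltr0n.
have s0 : 0 < Num.sqrt n%:R :> R by rewrite sqrtr_gt0.
have -> : (Num.sqrt n%:R)^-1 `^ (2 + g) = (Num.sqrt n%:R `^ (2 + g))^-1 :> R.
  by rewrite -powRN -powR_inv1 ?(ltW s0)// -powRrM mulN1r.
rewrite powRD; last by apply/implyP => _; rewrite gt_eqF.
rewrite powR_mulrn ?(ltW s0)// sqr_sqrtr ?(ltW nR)// -powR12_sqrt ?(ltW nR)//.
rewrite -powRrM [2^-1 * g]mulrC invfM mulrA mulfV ?mul1r//.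
by rewrite gt_eqF.
Qed.

Theorem theorem1p2 (R : realType) (d : nat) (Sigma : 'M[R]_d) :
  (1 <= d)%N -> Sigma \in unitmx ->
  exists C : R -> R, (forall K, 0 < C K) /\
  forall (dT dU : measure_display) (T : measurableType dT)
    (U : measurableType dU) (P : probability T R) (Q : probability U R)
    (X : nat -> {RV P >-> borel_rV R d}) (xi : {RV Q >-> borel_rV R d}),
    mutually_independent X ->
    identically_distributed X ->
    (forall k, centered (X k)) ->
    (forall k, has_covariance (X k) Sigma) ->
    gaussian_vector xi Sigma ->
  forall f : 'rV[R]_d -> R,
    Ck 4 f -> vanishes_at_infinity f ->
  forall (gamma : R) (n : nat), 0 < gamma -> gamma <= 1 -> (1 <= n)%N ->
    (`| 'E_P[fun w => f (normalized_sum X n w)]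
        - 'E_Q[fun w => f (rv_val (xi w))] |
     <= (C (Ck_norm 4 f))%:E
        * 'E_P[fun w => (enorm (rv_val (X 0%N w)) `^ (2 + gamma))%R]
        * ((n%:R `^ (gamma / 2))^-1)%R%:E)%E.
Proof.
move=> d1 SU.
(* [c0] bounds the moment of the summands below and [CW] bounds the Gaussian moment above, both
   uniformly in the exponent. *)
pose c0 := Num.min 1 (Num.sqrt (\tr Sigma / 2)) * (\tr Sigma / 2).
pose CW := 1 + \sum_(i < d) \sum_(k < d)
  (Sigma i i ^+ 2 * normal_fourth_moment R + Sigma k k ^+ 2 * normal_fourth_moment R).
have tc0 : 0 <= taylor_const R d.
  by rewrite /taylor_const !(addr_ge0, mulr_ge0).
(* The factor [1 + |CW / c0|] pays for absorbing the Gaussian moment. The absolute value of [K] and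
   the final [1] make the constant positive at every real [K]. *)
exists (fun K => taylor_const R d * `|K| * (1 + `|CW / c0|) + 1); split.
  by move=> K; rewrite ltr_wpDl// !mulr_ge0// addr_ge0.
move=> dT dU T U P Q X xi indX idX cX covX [l [A [Z [AS indZ lawZ aexi]]]] f Cf _ g n g0 g1 n1.
have tr0 : 0 < \tr Sigma by rewrite -AS unitmx_tr_mul_gt0// AS.
set C := _ + 1.
have C0 : 0 < C by rewrite /C ltr_wpDl// !mulr_ge0// addr_ge0.
have nR : (0 : R) < n%:R by rewrite ltr0n.
have r0 : 0 < (n%:R `^ (g / 2))^-1 :> R by rewrite invr_gt0 powR_gt0.
rewrite ![in leRHS]unlock.
have M0 : (0 <= \int[P]_w (enorm (rv_val (X 0%N w)) `^ (2 + g))%:E)%E.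
  by apply: integral_ge0 => w _; rewrite lee_fin powR_ge0.
(* With an infinite moment the right-hand side is [+oo], since the constant and the rate are
   strictly positive. *)
have [Moo|Mfin] := eqVneq (\int[P]_w (enorm (rv_val (X 0%N w)) `^ (2 + g))%:E)%E +oo%E.
  by rewrite Moo gt0_muley ?lte_fin// gt0_mulye ?lte_fin// leey.
have Mlt : (\int[P]_w (enorm (rv_val (X 0%N w)) `^ (2 + g))%:E < +oo)%E.
  by rewrite ltey.
have hX := centered_has_moments (cX 0%N) (covX 0%N) Mlt.
have [M' hW M'CW] := gaussian_comb_moments A indZ lawZ g0 g1.
rewrite AS in hW M'CW.
have Mc := moment_lower_bound g0 g1 tr0 hX.
have [_ _ _ [_ EM]] := hX; rewrite EM.
move: hX EM Mc; set M := fine _ => hX EM Mc.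
set h := (Num.sqrt (n%:R : R))^-1.
have h0 : 0 <= h by rewrite invr_ge0 sqrtr_ge0.
have [B B0 hB] := Ck_bounded Cf.
pose G (y : borel_rV R d) : \bar R := (f y + B)%:E.
have mf := continuous_measurable_rV (Ck_continuous Cf).
have nmG : nonneg_measurable G.
  split; first by apply/measurable_EFinP; exact: measurable_funD.
  by move=> x; rewrite lee_fin; have := hB x; rewrite ler_norml => /andP[+ _]; lra.
have mu (i : nat) : measurable_fun [set: borel_rV R d] (fun y => h *: y : borel_rV R d).
  exact: (measurable_funZ_rV (measurable_cst _) (@measurable_id _ (borel_rV R d) setT)).
have SE w : normalized_sum X n w = \sum_(i <- index_iota 0 n) h *: X i w.
  by rewrite /normalized_sum scaler_sumr big_mkord.
have mS : measurable_fun [set: T] (normalized_sum X n : T -> borel_rV R d).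
  rewrite (_ : normalized_sum X n = fun w => \sum_(i <- index_iota 0 n) h *: X i w).
    exact: (measurable_sum_rV X mu).
  exact/funext.
have [u hu] := has_mean_Ck Cf P mS.
have [v hv] := has_mean_Ck Cf Q (measurable_gaussian_comb A Z).
(* Independence produces a chain of [n] averages, one for each summand; identical distribution makes
   them powers of a single operator. *)
have EX : iter n (avg P (fun w => h *: X 0%N w)) G 0 = (u + B)%:E.
  have [_ <-] := has_meanD hu (has_mean_cst P B).
  have := integral_independent_sum indX mu 0 (iota_uniq 0 (n - 0)) nmG.
  rewrite -/(index_iota 0 n) => E.
  have FI s : foldr (fun i => avg P (fun w => h *: X i w)) G s =
      iter (size s) (avg P (fun w => h *: X 0%N w)) G.
    elim: s => //= i s ->.
    apply: identically_distributed_avg => //; apply: nonneg_measurable_iter => //.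
    move=> k; apply: nonneg_measurable_avg.
    by apply: (measurable_funZ_rV (measurable_cst _)); exact: measurable_funP.
  move: E; rewrite FI size_iota subn0 => <-.
  by apply: eq_integral => w _; rewrite add0r SE.
(* The merged scale is [h * Num.sqrt n%:R = 1], so the iterate is the average over the Gaussian
   vector itself. *)
have EW : iter n (avg Q (fun w => h *: gaussian_comb A Z w)) G 0 = (v + B)%:E.
  rewrite iter_avg_gaussian_comb// mulVf; last by rewrite gt_eqF// sqrtr_gt0.
  have [_ <-] := has_meanD hv (has_mean_cst Q B).
  by apply: eq_integral => w _; rewrite add0r scale1r.
have Exi : ('E_Q[fun w => f (rv_val (xi w))] = v%:E)%E.
  have [_ <-] := hv; rewrite unlock; apply: ae_eq_integral => //.
  - apply/measurable_EFinP; apply: (measurableT_comp mf); exact: measurable_funP.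
  - by apply/measurable_EFinP; apply: (measurableT_comp mf); exact: measurable_gaussian_comb.
  - apply: filterS aexi => w hw _; congr (f _)%:E.
    by apply/rowP => i; rewrite hw -gaussian_combE.
have ES : ('E_P[fun w => f (normalized_sum X n w)] = u%:E)%E.
  by have [_ <-] := hu; rewrite unlock.
rewrite Exi ES -EFinB abse_EFin -!EFinM lee_fin.
have := lindeberg Cf g0 g1 h0 hX hW hB EX EW.
set K := Ck_norm 4 f; have K0 : 0 <= K by exact: Ck_norm_ge0.
set r := (n%:R `^ (g / 2))^-1 in r0 *.
have -> : n%:R * (taylor_const R d * K * (h `^ (2 + g) * (M + M'))) =
    taylor_const R d * K * (M + M') * r.
  by rewrite /r -sqrt_inv_powR// -/h; ring.
move=> H; apply: (le_trans H); rewrite ler_wpM2r ?(ltW r0)//.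
have c0_gt0 : 0 < c0.
  by rewrite mulr_gt0 ?divr_gt0// lt_min ltr01 sqrtr_gt0 divr_gt0.
have M_ge0 : 0 <= M by exact: le_trans (ltW c0_gt0) Mc.
(* Since [c0 <= M], the bound [CW = (CW / c0) * c0] is at most [|CW / c0| * M]. *)
have M'M : M' <= `|CW / c0| * M.
  rewrite (le_trans M'CW)// -/CW (le_trans (ler_norm _))//.
  rewrite -[X in `|X| <= _](divfK (lt0r_neq0 c0_gt0)) normrM ler_wpM2l//.
  by rewrite gtr0_norm.
rewrite /C (ger0_norm K0).
have tK : 0 <= taylor_const R d * K by exact: mulr_ge0.
rewrite (@le_trans _ _ (taylor_const R d * K * (1 + `|CW / c0|) * M))//.
  by rewrite -[leRHS]mulrA ler_wpM2l// mulrDl mul1r lerD2l.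
by rewrite ler_wpM2r// lerDl.
Qed.
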